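(* Let $p$ be an odd prime, let $a\in\mathbb{F}_p$, and let $k$ and $m$ be positive integers. Then the $L$-polynomial over $\mathbb{F}_p$ of the curve $C_{km}^{(p,a)}$ is divisible by the $L$-polynomial over $\mathbb{F}_p$ of the curve $C_k^{(p,a)}$.
   Context: For a positive integer $k$ and $a\in\mathbb{F}_p$, $C_k^{(p,a)}$ denotes the smooth projective absolutely irreducible curve over $\mathbb{F}_p$ with affine equation $y^p-y=x^{p^k+1}+ax$. It has genus $p^k(p-1)/2$ and exactly one point at infinity, which is rational, so $\#C_k^{(p,a)}(\mathbb{F}_{p^n})$ is $1$ plus the number of solutions $(x,y)\in\mathbb{F}_{p^n}^2$ of the affine equation. The $L$-polynomial of a smooth projective absolutely irreducible curve $X$ of genus $g$ over $\mathbb{F}_q$ is $L_X(T)=\exp\left(\sum_{n\ge1}(\#X(\mathbb{F}_{q^n})-q^n-1)\frac{T^n}{n}\right)$, a polynomial of degree $2g$ with integer coefficients and constant term $1$. *)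

(* Defs.v *)
From HB Require Import structures.
From mathcomp Require Import all_boot all_algebra all_field.
Set Implicit Arguments.
Unset Strict Implicit.
Unset Printing Implicit Defensive.
Import GRing.Theory.
Local Open Scope ring_scope.

(* Formal power series over Q are represented by their coefficient sequences.
   [exp_coef f] is the coefficient sequence of exp(f) = \sum_j f^j / j!, for a
   series f without constant term: the coefficient of T^i in f^j only depends
   on f modulo T^(i+1), and it vanishes when i < j. *)
Definition exp_coef (f : nat -> rat) (i : nat) : rat :=
  \sum_(j < i.+1) ((\poly_(l < i.+1) f l) ^+ j)`_i / j`!%:R.

(* The series \sum_(n >= 1) (N n - q^n - 1) T^n / n. *)
Definition log_coef (q : nat) (N : nat -> nat) (n : nat) : rat :=
  if n == 0%N then 0 else ((N n)%:R - q%:R ^+ n - 1) / n%:R.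

(* L is the L-polynomial of a curve over F_q that has N n points over F_(q^n)
   for all n >= 1. *)
Definition is_Lpolynomial (q : nat) (N : nat -> nat) (L : {poly int}) : Prop :=
  forall i : nat, (L`_i)%:~R = exp_coef (log_coef q N) i.

(* The field with p^n elements for n > 0; a junk value (F_p) for n = 0. *)
Definition Fpn (p : nat) (pr_p : prime p) (n : nat) : finFieldType :=
  s2val (pPrimePowerField pr_p (ltn0Sn n.-1)).

Lemma pchar_Fpn (p : nat) (pr_p : prime p) (n : nat) :
  p \in [pchar (Fpn pr_p n)].
Proof. exact: s2valP (pPrimePowerField pr_p (ltn0Sn n.-1)). Qed.

Lemma card_Fpn (p : nat) (pr_p : prime p) (n : nat) :
  (0 < n)%N -> #|Fpn pr_p n| = (p ^ n)%N.
Proof. by move=> n_gt0; rewrite (s2valP' (pPrimePowerField pr_p _)) prednK. Qed.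

(* Solutions (x, y) in F^2 of y^p - y = x^(p^k + 1) + a x, for F of
   characteristic p; a%:R is then the image of a : 'F_p (read as a natural
   number) under the inclusion of F_p into F. *)
Definition affine_points (p k : nat) (a : 'F_p) (F : finFieldType) :
    {set F * F} :=
  [set P : F * F |
     P.2 ^+ p - P.2 == P.1 ^+ (p ^ k + 1)%N + (a : nat)%:R * P.1].

(* Number of F_(p^n)-points of the smooth projective model of
   y^p - y = x^(p^k + 1) + a x: a single point, which is rational, lies at
   infinity. *)
Definition curve_points (p : nat) (pr_p : prime p) (k : nat) (a : 'F_p)
    (n : nat) : nat :=
  (#|affine_points k a (Fpn pr_p n)| + 1)%N.

Definition is_curve_Lpolynomial (p : nat) (pr_p : prime p) (k : nat)
    (a : 'F_p) (L : {poly int}) : Prop :=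
  is_Lpolynomial p (curve_points pr_p k a) L.

(* Divisibility in Z[T]. The library's %| on {poly int} is defined by
   pseudo-division, hence is divisibility in Q[T]. *)
Definition dvd_polyZ (P Q : {poly int}) : Prop :=
  exists R : {poly int}, Q = R * P.

(* Main.v *)
Require Import Defs.
From mathcomp Require Import all_boot all_order all_algebra all_solvable all_field.
From mathcomp Require Import ring zify.
Set Implicit Arguments.
Unset Strict Implicit.
Unset Printing Implicit Defensive.
Import Order.TTheory GRing.Theory Num.Theory.
Local Open Scope ring_scope.

(* Substituting x = z - a/2 turns tr (x^(p^k + 1) + a x) into
   tr (z^(p^k + 1)) - n a^2 / 4 over the field with p^n elements, so that only
   the value distribution of the quadratic forms tr (z^(p^k + 1)) matters. With
   d = gcd(k, n), the exponent may be replaced by its gcd with p^n - 1, which is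
   2 if n / d is odd and p^d + 1 if n / d is even. In the second case the
   absolute value of the character sum is given by the radical
   z^(p^(2d)) = - z, and its sign by a congruence modulo p^d + 1.

   Hence #C_k - #C_km over that field vanishes for n odd, and is otherwise
   p^(n/2) w(n) times p - 1 or p [p | n] - 1, where w is even and periodic of
   period 4km, and w(0) = p^(km) - p^k is at least the sum of the |w(r)| for
   0 < r < 4km. The Fourier coefficients of w are therefore nonnegative, so the
   difference of the point counts is a combination of powers z^n with
   nonnegative coefficients. By linear independence of the functions z^n,
   every reciprocal root of L_k is one of L_km, with at least the same
   multiplicity. *)

(** * Newton's identities and L-polynomials *)

Section ExpCoef.
Variable (f : nat -> rat).
Hypothesis f0 : f 0%N = 0.

Let trunc n : {poly rat} := \poly_(l < n) f l.

Let truncX n j i : (i < j)%N -> ((trunc n) ^+ j)`_i = 0.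
Proof.
have [Q ->] : exists Q, trunc n = Q * 'X.
  exists (\poly_(l < n.-1) f l.+1); apply/polyP=> -[|l]; rewrite coefMX !coef_poly //=.
    by rewrite f0; case: ifP.
  by case: n.
by move=> ltij; rewrite exprMn coefMXn ltij.
Qed.

(** The truncations at [n] and at [i.+1] differ by a multiple of X^(i+1), and a difference of [j]-th
    powers is a multiple of the difference of the bases. *)
Let trunc_expE n j i : (i < n)%N -> ((trunc n) ^+ j)`_i = ((trunc i.+1) ^+ j)`_i.
Proof.
move=> ltin; apply/eqP; rewrite -subr_eq0 -coefB; apply/eqP.
have -> : trunc n = trunc i.+1 + drop_poly i.+1 (trunc n) * 'X^(i.+1).
  rewrite -[LHS](poly_take_drop i.+1); congr (_ + _); apply/polyP=> l.
  rewrite coef_take_poly !coef_poly; case: (ltnP l i.+1) => //= lt.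
  by rewrite (leq_trans lt).
by rewrite subrXX [_ + _ - _]addrC addKr mulrAC coefMXn ltnS leqnn.
Qed.

Let expE n i : (i < n)%N ->
  exp_coef f i = (\sum_(j < n) j`!%:R^-1 *: trunc n ^+ j)`_i.
Proof.
move=> ltin; rewrite coef_sum /exp_coef -/(trunc _).
rewrite (big_ord_widen n (fun j => (trunc i.+1 ^+ j)`_i / j`!%:R) ltin) big_mkcond /=.
apply: eq_bigr => j _; rewrite coefZ (trunc_expE _ ltin) [RHS]mulrC.
by case: ltnP => [//|leij]; rewrite truncX ?mul0r.
Qed.

Lemma exp_coef0 : exp_coef f 0 = 1.
Proof. by rewrite /exp_coef big_ord1 expr0 coef1 fact0 divr1. Qed.

Lemma exp_coefS i :
  exp_coef f i.+1 * i.+1%:R =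
  \sum_(j < i.+1) (f j.+1 * j.+1%:R) * exp_coef f (i - j).
Proof.
pose n := i.+2; pose E : {poly rat} := \sum_(j < n) j`!%:R^-1 *: trunc n ^+ j.
(* Derivation shifts the truncated exponential by one term, so its last term is missing on the
   right. As n = i + 2, that term is the power [i.+1] of a series without constant term and has no
   coefficient in degree at most [i]. *)
have dE : E^`() = (trunc n)^`() * (E - (n.-1)`!%:R^-1 *: trunc n ^+ n.-1).
  rewrite [in RHS]/E [in RHS]big_ord_recr /= addrK /E raddf_sum big_ord_recl /=.
  rewrite expr0 derivZ derivC scaler0 add0r.
  rewrite mulr_sumr; apply: eq_bigr => j _; rewrite derivZ deriv_exp /= /bump /= add1n -scalerAr.
  rewrite -scaler_nat scalerA mulrC; congr (_ *: _).
    rewrite factS natrM invfM mulrA mulfV ?mul1r //.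
    by rewrite pnatr_eq0.
have := congr1 (fun q : {poly rat} => q`_i) dE.
rewrite coef_deriv -(expE (ltnSn i.+1)) mulr_natr => ->.
rewrite mulrBr coefB -scalerAr coefZ.
have -> : ((trunc n)^`() * trunc n ^+ n.-1)`_i = 0.
  by rewrite coefMr big1 // => j _; rewrite truncX ?mul0r ?mulr0 //=; lia.
rewrite mulr0 subr0 coefM; apply: eq_bigr => j _.
rewrite coef_deriv coef_poly ltnS ltn_ord -mulr_natr mul1r -expE ?mulr_natr //.
by rewrite /n; lia.
Qed.

End ExpCoef.

(* Coefficientwise form of [P(0) = 1] and [X P' = P * \sum_(n >= 1) c_n X^n],
   i.e. of [P = exp (\sum_(n >= 1) c_n X^n / n)]. *)
Definition newton (R : nzRingType) (P : {poly R}) (c : nat -> R) : Prop :=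
  P`_0 = 1 /\
  forall i, P`_i.+1 * i.+1%:R = \sum_(j < i.+1) c j.+1 * P`_(i - j).

(** The constant term 1 makes the identities triangular in the [c n], so they determine them one
    after another. *)
Lemma newton_inj (R : nzRingType) (P : {poly R}) (c d : nat -> R) :
  newton P c -> newton P d -> forall n, (0 < n)%N -> c n = d n.
Proof.
move=> [P0 cP] [_ dP] [//|n] _; elim/ltn_ind: n => n IH.
have := dP n; rewrite cP !big_ord_recr /= subnn P0 !mulr1.
have -> : \sum_(i < n) c i.+1 * P`_(n - i) = \sum_(i < n) d i.+1 * P`_(n - i).
  by apply: eq_bigr => i _; rewrite IH.
by apply: addrI.
Qed.

Lemma newton_prod (R : comNzRingType) (s : seq R) :
  newton (\prod_(x <- s) (1 - x *: 'X)) (fun n => - \sum_(x <- s) x ^+ n).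
Proof.
elim: s => [|x s [Q0 IH]].
  split=> [|i]; rewrite big_nil coef1 //= mul0r big1 // => j _.
  by rewrite big_nil oppr0 mul0r.
rewrite big_cons; set Q := \prod_(_ <- s) _ in Q0 IH *.
set P := (1 - _) * _.
have PS n : P`_n.+1 = Q`_n.+1 - x * Q`_n.
  by rewrite /P mulrBl mul1r coefB -scalerAl coefZ coefXM.
have P0 : P`_0 = Q`_0 by rewrite /P mulrBl mul1r coefB -scalerAl coefZ coefXM mulr0 subr0.
split=> [|i]; first by rewrite P0.
(* This multiplies [P] = (1 - xX) [Q] by the geometric series xX / (1 - xX), which is, up to sign,
   what the new factor adds to the logarithmic derivative. *)
have geom n : \sum_(j < n.+1) x ^+ j.+1 * P`_(n - j) = x * Q`_n.
  elim: n => [|n IHn]; first by rewrite big_ord1 P0.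
  rewrite big_ord_recl /= subn0 PS expr1.
  have -> : \sum_(j < n.+1) x ^+ (bump 0 j).+1 * P`_(n.+1 - bump 0 j) = x * (x * Q`_n).
    rewrite -IHn mulr_sumr; apply: eq_bigr => j _.
    by rewrite /bump /= add1n subSS exprS mulrA.
  by rewrite -mulrDr subrK.
under eq_bigr => j _ do rewrite big_cons opprD mulrDl mulNr.
rewrite big_split /= sumrN geom.
set c := fun j : nat => - \sum_(y <- s) y ^+ j.+1.
have -> : \sum_(j < i.+1) c j * P`_(i - j) = Q`_i.+1 * i.+1%:R - x * (Q`_i * i%:R).
  rewrite big_ord_recr /= subnn P0.
  have -> : \sum_(j < i) c j * P`_(i - j) =
      \sum_(j < i) c j * Q`_(i - j) - x * (Q`_i * i%:R).
    case: i => [|i]; first by rewrite !big_ord0 !mulr0 subr0.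
    rewrite IH mulr_sumr -sumrB; apply: eq_bigr => j _.
    have -> : (i.+1 - j = (i - j).+1)%N by rewrite subSn // -ltnS.
    by rewrite PS -/(c j); ring.
  by rewrite IH big_ord_recr /= subnn -/(c _); ring.
by rewrite PS -natr1; ring.
Qed.

(** The entries of [s] are the inverses of the roots of [P], which are nonzero because P(0) = 1. The
    same normalization forces the leftover constant [u] to be 1. *)
Lemma newton_split (F : closedFieldType) (P : {poly F}) (c : nat -> F) :
  newton P c -> exists2 s : seq F,
    P = \prod_(x <- s) (1 - x *: 'X) & forall n, (0 < n)%N -> c n = - \sum_(x <- s) x ^+ n.
Proof.
move=> Pc; have [P0 _] := Pc; have [r Pr] := closed_field_poly_normal P.
suff [s Ps] : exists s : seq F, P = \prod_(x <- s) (1 - x *: 'X).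
  by exists s => //; apply: newton_inj Pc _; rewrite Ps; apply: newton_prod.
have r0 : all (fun z => z != 0) r.
  apply/allP=> z zr; apply/negP=> /eqP z0; have : root P 0.
    by rewrite Pr rootE hornerZ mulf_eq0 -(rootE (\prod_(_ <- r) _)) root_prod_XsubC -z0 zr orbT.
  by rewrite rootE horner_coef0 P0 oner_eq0.
have [u Pu] : exists u, P = u%:P * \prod_(z <- r) (1 - z^-1 *: 'X).
  rewrite Pr -mul_polyC; elim: r r0 (lead_coef P) {Pr} => [|z r IH] /=.
    by move=> _ u; exists u; rewrite !big_nil.
  move=> /andP[z0 r0] u; have [v Ev] := IH r0 u; exists (- z * v).
  have XzE : 'X - z%:P = (- z)%:P * (1 - z^-1 *: 'X).
    have zV : - z / z = -1 by rewrite mulNr divff.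
    by rewrite mulrBr mulr1 -mul_polyC mulrA -polyCM zV !polyCN; ring.
  by rewrite !big_cons mulrCA Ev XzE polyCM; ring.
exists [seq z^-1 | z <- r]; rewrite big_map Pu (_ : u = 1) ?mul1r //.
move: P0; rewrite Pu -horner_coef0 !hornerE horner_prod big1 ?mulr1 // => z _.
by rewrite !hornerE ?mulr0 ?subr0.
Qed.

Lemma is_Lpolynomial_newton (q : nat) (N : nat -> nat) (L : {poly int}) :
  is_Lpolynomial q N L ->
  newton (map_poly intr L : {poly algC}) (fun n => (N n)%:R - q%:R ^+ n - 1).
Proof.
move=> LP; have LE i : (map_poly intr L : {poly algC})`_i = ratr (exp_coef (log_coef q N) i).
  by rewrite coef_map /= -LP ratr_int.
have f0 : log_coef q N 0 = 0 by rewrite /log_coef eqxx.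
split=> [|i]; first by rewrite LE exp_coef0 rmorph1.
rewrite LE -(ratr_nat _ i.+1) -rmorphM (exp_coefS f0) rmorph_sum.
apply: eq_bigr => j _; rewrite LE rmorphM; congr (_ * _).
rewrite /log_coef /= divfK ?pnatr_eq0 // !rmorphB rmorphXn /= !ratr_nat rmorph1 //.
Qed.

(** By Gauss's lemma the quotient by the primitive part of [P] is integral, and the constant term 1
    makes the content of [P] a unit. *)
Lemma dvd_polyZ_algC (P Q : {poly int}) :
  P`_0 = 1 -> (map_poly intr P : {poly algC}) %| map_poly intr Q -> dvd_polyZ P Q.
Proof.
move=> P0 PQ; have {PQ} : P %| Q.
  rewrite -dvdp_rat_int -(dvdp_map (ratr : {rmorphism rat -> algC})).
  by rewrite -!map_poly_comp !(eq_map_poly (fun z => ratr_int _ z)).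
move=> /dvdpP_int[R ->]; have := zpolyEprim P; set c := zcontents P => Pc.
have cU : c * (zprimitive P)`_0 = 1 by rewrite -coefZ -Pc.
exists ((zprimitive P)`_0 *: R); rewrite [X in _ = _ * X]Pc -scalerAl -scalerAr scalerA.
by rewrite [_ * c]mulrC cU scale1r mulrC.
Qed.

(* Restrictions to n > 0 of the functions n |-> \sum_i c_i z_i ^ n with
   coefficients c_i >= 0. *)
Definition effective (f : nat -> algC) : Prop :=
  exists2 s : seq (algC * algC), all (fun x => 0 <= x.1) s &
    forall n, (0 < n)%N -> f n = \sum_(x <- s) x.1 * x.2 ^+ n.

Lemma effective_ext (f g : nat -> algC) :
  (forall n, (0 < n)%N -> f n = g n) -> effective f -> effective g.
Proof. by move=> fg [s s0 fs]; exists s => // n n0; rewrite -fg ?fs. Qed.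

Lemma effective_sum (I : Type) (r : seq I) (c z : I -> algC) :
  (forall i, 0 <= c i) -> effective (fun n => \sum_(i <- r) c i * z i ^+ n).
Proof.
move=> c0; exists [seq (c i, z i) | i <- r] => [|n _]; last by rewrite big_map.
by elim: r => //= i r ->; rewrite c0.
Qed.

Lemma effectiveM (f g : nat -> algC) :
  effective f -> effective g -> effective (fun n => f n * g n).
Proof.
move=> [s s0 fs] [t t0 gt]; exists [seq (x.1 * y.1, x.2 * y.2) | x <- s, y <- t].
  apply/allP=> _ /allpairsP[[x y] [xs yt ->]] /=.
  by rewrite mulr_ge0 // ?(allP s0 _ xs) ?(allP t0 _ yt).
move=> n n0; rewrite big_allpairs_dep fs // gt // mulr_suml; apply: eq_bigr => x _.
by rewrite mulr_sumr; apply: eq_bigr => y _; rewrite /= exprMn; ring.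
Qed.

(* Testing the identity of power sums against a polynomial without constant
   term isolates one base: the functions n |-> z ^ n are independent. *)
Lemma effective_count (s t : seq algC) :
  effective (fun n => \sum_(x <- t) x ^+ n - \sum_(x <- s) x ^+ n) ->
  forall z, z != 0 -> (count_mem z s <= count_mem z t)%N.
Proof.
move=> [u u0 Eu] z z0.
have test (P : {poly algC}) : \sum_(x <- t) x * P.[x] - \sum_(x <- s) x * P.[x] =
    \sum_(x <- u) x.1 * (x.2 * P.[x.2]).
  have PE (x : algC) : x * P.[x] = \sum_(i < size P) P`_i * x ^+ i.+1.
    by rewrite horner_coef mulr_sumr; apply: eq_bigr => i _; rewrite exprS mulrCA.
  under eq_bigr => x _ do rewrite PE.
  under [X in _ - X = _]eq_bigr => x _ do rewrite PE.
  under [RHS]eq_bigr => x _ do rewrite PE mulr_sumr.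
  rewrite exchange_big [X in _ - X = _]exchange_big [RHS]exchange_big /= -sumrB.
  apply: eq_bigr => i _; rewrite -!mulr_sumr -mulrBr Eu // mulr_sumr.
  by apply: eq_bigr => x _; rewrite mulrCA.
pose r := [seq x <- s ++ t ++ [seq x.2 | x <- u] | x != z].
pose P := \prod_(x <- r) ('X - x%:P).
have Pz : P.[z] != 0 by rewrite -rootE root_prod_XsubC mem_filter eqxx.
have Pnz x : x \in s ++ t ++ [seq x.2 | x <- u] -> x != z -> P.[x] = 0.
  by move=> xr xz; apply/eqP; rewrite -rootE root_prod_XsubC mem_filter xz.
have cnt (v : seq algC) : {subset v <= s ++ t ++ [seq x.2 | x <- u]} ->
    \sum_(x <- v) x * P.[x] = (count_mem z v)%:R * (z * P.[z]).
  move=> vr; rewrite -sum1_count natr_sum mulr_suml [RHS]big_mkcond /=.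
  rewrite big_seq [RHS]big_seq; apply: eq_bigr => x xv.
  by have [->|xz] := eqVneq x z; rewrite ?mul1r // Pnz ?mulr0 ?vr.
have := test P; rewrite !cnt => [E|x|x]; rewrite ?mem_cat; last 2 first.
- by move=> ->.
- by move=> ->; rewrite orbT.
have {}E : (count_mem z t)%:R - (count_mem z s)%:R =
    \sum_(x <- u | x.2 == z) x.1 :> algC.
  apply: (mulIf (mulf_neq0 z0 Pz)); rewrite mulrBl E mulr_suml [RHS]big_mkcond /=.
  rewrite big_seq [RHS]big_seq; apply: eq_bigr => x xu.
  have [->//|xz] := eqVneq x.2 z; rewrite Pnz ?mulr0 //.
  by rewrite !mem_cat (map_f snd xu) !orbT.
rewrite -(ler_nat algC) -subr_ge0 E big_seq_cond sumr_ge0 // => x /andP[xu _].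
exact: (allP u0).
Qed.

(** By Newton's identities N(n) is q^n + 1 minus the n-th power sum of the reciprocal roots of [L].
    The difference of the counts is thus a difference of power sums, and [effective_count] compares
    the multiplicities. *)
Theorem dvd_Lpolynomial (q : nat) (N N' : nat -> nat) (L L' : {poly int}) :
  is_Lpolynomial q N L -> is_Lpolynomial q N' L' ->
  effective (fun n => (N n)%:R - (N' n)%:R) -> dvd_polyZ L L'.
Proof.
move=> LN LN' eff; apply: dvd_polyZ_algC.
  by apply: (@intr_inj rat); rewrite LN exp_coef0.
have nL := is_Lpolynomial_newton LN; have nL' := is_Lpolynomial_newton LN'.
have [s Ls Ns] := newton_split nL; have [t Lt Nt] := newton_split nL'.
have {eff} cnt : forall z, z != 0 -> (count_mem z s <= count_mem z t)%N.
  apply: effective_count; apply: effective_ext eff => n n0.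
  have := Ns n n0; have := Nt n n0; move: (\sum_(_ <- _) _) (\sum_(_ <- _) _) => x y Ex Ey.
  by rewrite -[x]opprK -[y]opprK -Ex -Ey; ring.
(* Zero entries escape [effective_count], but they only contribute factors 1. *)
have nz (v : seq algC) : \prod_(x <- v) (1 - x *: 'X) =
    \prod_(x <- [seq x <- v | x != 0]) (1 - x *: 'X : {poly algC}).
  rewrite big_filter [RHS]big_mkcond; apply: eq_bigr => x _.
  by case: eqP => //= ->; rewrite scale0r subr0.
rewrite Ls Lt nz [X in _ %| X]nz.
have [v /perm_to_subseq[w tvw] sv] : exists2 v, subseq v [seq x <- t | x != 0] &
    perm_eq [seq x <- s | x != 0] v.
  apply/count_subseqP => z; rewrite !count_filter.
  have [->|z0] := eqVneq z 0; first by rewrite !(@eq_count _ _ pred0) ?count_pred0 // => x /=;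
    case: eqP => // ->; rewrite eqxx.
  by rewrite !(@eq_count _ (predI _ _) (pred1 z)) ?cnt // => x /=; case: eqP => // ->.
by rewrite (perm_big _ sv) (perm_big _ tvw) big_cat dvdp_mulr.
Qed.

(** * Functions with nonnegative Fourier coefficients *)

Lemma sum_prim_root (R : idomainType) (K : nat) (z : R) (m : nat) :
  K.-primitive_root z -> \sum_(j < K) (z ^+ m) ^+ j = (K * (K %| m))%:R.
Proof.
move=> zK; rewrite (prim_order_dvd zK); have [->|zm1] := eqVneq (z ^+ m) 1.
  by under eq_bigr => j _ do rewrite expr1n; rewrite sumr_const card_ord muln1.
rewrite -subr_eq0 in zm1; rewrite muln0; apply: (mulfI zm1).
by rewrite -subrX1 exprAC (prim_expr_order zK) expr1n subrr mulr0.
Qed.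

Lemma effective_nonneg (c : algC) : 0 <= c -> effective (fun=> c).
Proof.
move=> c0; exists [:: (c, 1)] => [|n _]; first by rewrite /= c0.
by rewrite big_seq1 /= expr1n mulr1.
Qed.

(** This is the sum of z^n over the p-th roots of unity z other than 1. *)
Lemma effective_dvdn (p : nat) :
  (0 < p)%N -> effective (fun n => (p * (p %| n))%:R - 1).
Proof.
case: p => // p _; have [z zp] := C_prim_root_exists (ltn0Sn p).
apply: effective_ext (@effective_sum _ (index_enum 'I_p) (fun=> 1)
  (fun j : 'I_p => z ^+ j.+1) _) => [n _|i]; last exact: ler01.
rewrite -(sum_prim_root n zp) big_ord_recl expr0 [1 + _]addrC addrK.
by apply: eq_bigr => j _; rewrite mul1r exprAC.
Qed.

(** With s a square root of q, the function is (s^n + (-s)^n) / 2. *)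
Lemma effective_half_power (q : nat) :
  effective (fun n => if odd n then 0 else (q ^ n./2)%:R).
Proof.
pose s := sqrtC q%:R : algC; exists [:: (2^-1, s); (2^-1, - s)].
  by rewrite /= !invr_ge0 ler0n.
move=> n _; rewrite big_cons big_seq1 /= -mulrDr exprNn -signr_odd.
case: ifP => [_|odd_n]; first by rewrite expr1 mulN1r subrr mulr0.
rewrite -[n in s ^+ n]odd_double_half odd_n add0n -mul2n exprM sqrtCK expr0 mul1r.
by rewrite natrX -mulr2n -(mulr_natl (q%:R ^+ _)) mulKf ?pnatr_eq0.
Qed.

(* The coefficients of the discrete Fourier transform of f are real since f is
   even, and nonnegative since f(0) dominates the other values. *)
Lemma effective_periodic (K : nat) (f : nat -> int) :
  (0 < K)%N -> (forall n, f (n %% K)%N = f n) ->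
  (forall n, (n <= K)%N -> f (K - n)%N = f n) ->
  \sum_(1 <= r < K) `|f r| <= f 0%N -> effective (fun n => (f n)%:~R).
Proof.
move=> K0 fK fN dom; have [z zK] := C_prim_root_exists K0.
(* These are the discrete Fourier coefficients of [f]; the exponent [K - r] stands for -r. *)
pose c (j : 'I_K) := K%:R^-1 * \sum_(r < K) (f r)%:~R * z ^+ (j * (K - r)).
have KK : K%:R != 0 :> algC by rewrite pnatr_eq0 -lt0n.
apply: effective_ext (@effective_sum _ (index_enum 'I_K) c
  (fun j : 'I_K => z ^+ j) _) => [n _|j].
  under eq_bigr => j _ do rewrite -mulrA mulr_suml.
  rewrite -mulr_sumr exchange_big /=; apply: (mulfI KK); rewrite mulVKf //.
  rewrite (bigD1 (Ordinal (ltn_pmod n K0))) //= [X in _ + X]big1 ?addr0 => [|r rn].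
    under eq_bigr => j _ do rewrite -mulrA -!exprM -exprD -mulnDr mulnC exprM.
    rewrite -mulr_sumr (sum_prim_root _ zK) fK (_ : (K %| _)%N) ?muln1 1?mulrC //.
    have : (K - n %% K + n = K * (n %/ K).+1)%N.
      have := ltn_pmod n K0; have := divn_eq n K.
      by move: (n %/ K)%N (n %% K)%N => a b; rewrite mulnS mulnC; lia.
    by move=> ->; rewrite dvdn_mulr.
  under eq_bigr => j _ do rewrite -mulrA -!exprM -exprD -mulnDr mulnC exprM.
  rewrite -mulr_sumr (sum_prim_root _ zK) (_ : (K %| _)%N = false) ?muln0 ?mulr0 //.
  apply: contraNF rn => /dvdnP[q Eq]; apply/eqP/val_inj => /=.
  have -> : (n = (q * K + r) - K)%N by rewrite -Eq; have := ltn_ord r; lia.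
  case: q Eq => [|q] Eq; first by have := ltn_ord r; lia.
  by rewrite mulSn -addnA addKn modnMDl modn_small.
rewrite /c; apply: mulr_ge0; first by rewrite invr_ge0 ler0n.
have zz m : (z ^+ m)^* = (z ^+ m)^-1.
  rewrite [RHS]invC_norm; have -> : `|z ^+ m| = 1; last by rewrite expr1n invr1 mul1r.
  rewrite normrX (_ : `|z| = 1) ?expr1n //; apply/eqP.
  by rewrite -(pexpr_eq1 K0) // -normrX (prim_expr_order zK) normr1.
have nz m : `|z ^+ m| = 1 :> algC.
  by apply/eqP; rewrite -(pexpr_eq1 (isT : 0 < 2)%N) // normCK zz divff // expf_eq0
    (prim_root_eq0 zK) gtn_eqF // andbF.
rewrite -(big_mkord predT (fun r => (f r)%:~R * z ^+ (j * (K - r)))) big_ltn //=.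
rewrite subn0 mulnC exprM (prim_expr_order zK) expr1n mulr1.
set Y := \sum_(1 <= r < K) _.
(* Conjugation inverts the roots of unity, which amounts to exchanging r and K - r; [f] is invariant
   under this. *)
have YR : Y \is Num.real.
  apply/CrealP; rewrite /Y rmorph_sum /= big_nat_rev /=; apply: eq_big_nat => r /andP[r1 rK].
  rewrite add1n subSS rmorphM /= rmorph_int zz fN ?(ltnW rK) //; congr (_ * _).
  apply: (mulIf (x := z ^+ (j * (K - (K - r))))).
    by rewrite expf_eq0 (prim_root_eq0 zK) gtn_eqF // andbF.
  rewrite mulVf; last by rewrite expf_eq0 (prim_root_eq0 zK) gtn_eqF // andbF.
  rewrite -exprD -mulnDr subKn ?(ltnW rK) // subnK ?(ltnW rK) // mulnC exprM.
  by rewrite (prim_expr_order zK) expr1n.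
have : `|Y| <= (f 0%N)%:~R.
  apply: le_trans (ler_norm_sum _ _ _) _.
  under eq_bigr => r _ do rewrite normrM nz mulr1 -intr_norm.
  by rewrite -(rmorph_sum (intmul 1)) ler_int.
by rewrite real_ler_norml // => /andP[+ _]; rewrite -subr_ge0 opprK addrC.
Qed.

(* For n even, - p ^ (n / 2) times this factor is the common value of the
   character sums of c x ^ (p ^ k + 1), c in F_p^*, over the field with p ^ n
   elements. *)
Definition sum_factor (p k n : nat) : int :=
  let t := (n %/ gcdn k n)%N in
  if odd t then (-1) ^+ (odd n./2 && (p %% 4 == 3)%N)
  else if (4 %| t)%N then (p ^ gcdn k n)%:Z else 1.

(** * Periodicity and domination of the differences of sign factors *)

Section Dominated.
Variables (p k L : nat).
Hypotheses (p_gt2 : (2 < p)%N) (k_gt0 : (0 < k)%N) (kL : (k %| L)%N) (k_lt_L : (k < L)%N).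

(** For k' dividing [L] and n even, the residue of n modulo 4L determines gcd(k', n), the parity of
    n / 2, and n / gcd(k', n) modulo 4; hence [K] is a period of [sum_factor]. *)
Let K := (4 * L)%N.

Let sum_factor_eq k' n n' :
  gcdn k' n = gcdn k' n' -> odd n./2 = odd n'./2 ->
  odd (n %/ gcdn k' n) = odd (n' %/ gcdn k' n') ->
  (4 %| n %/ gcdn k' n)%N = (4 %| n' %/ gcdn k' n')%N ->
  sum_factor p k' n = sum_factor p k' n'.
Proof. by rewrite /sum_factor => -> -> -> ->. Qed.

Let sum_factor_mod k' n : (0 < k')%N -> (k' %| L)%N -> ~~ odd n ->
  sum_factor p k' (n %% K) = sum_factor p k' n.
Proof.
move=> k'0 k'L on; have k'K : (k' %| K)%N by rewrite dvdn_mull.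
have gE : gcdn k' (n %% K) = gcdn k' n.
  by rewrite -[RHS]gcdn_modr -(modn_dvdm n k'K) gcdn_modr.
have g0 : (0 < gcdn k' n)%N by rewrite gcdn_gt0 k'0.
have [q Lq] : exists q, L = (q * gcdn k' n)%N.
  by exists (L %/ gcdn k' n)%N; rewrite divnK // (dvdn_trans (dvdn_gcdl _ _)).
have nE := divn_eq n K.
have tE : (n %/ gcdn k' n = 4 * (n %/ K * q) + (n %% K) %/ gcdn k' n)%N.
  rewrite -divnMDl //; congr (_ %/ _)%N; rewrite {1}nE; congr (_ + _)%N.
  by rewrite {2}/K Lq; move: (n %/ K)%N (gcdn _ _) => a b; clear; nia.
apply: sum_factor_eq; rewrite ?gE //.
- move: on nE; move: (n %/ K)%N (n %% K)%N => a b; rewrite /K mulnCA.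
  by move: (a * L)%N => c on nE; clear -on nE; lia.
- by rewrite [in RHS]tE oddD oddM.
- by rewrite [in RHS]tE dvdn_addr // dvdn_mulr.
Qed.

(** The quotients of K - n and n by their common gcd with k' add up to a multiple of 4, so they
    agree in parity and in divisibility by 4. *)
Let sum_factor_opp k' n : (0 < k')%N -> (k' %| L)%N -> ~~ odd n -> (n <= K)%N ->
  sum_factor p k' (K - n) = sum_factor p k' n.
Proof.
move=> k'0 k'L on nK; have k'K : (k' %| K)%N by rewrite dvdn_mull.
have gE : gcdn k' (K - n) = gcdn k' n.
  apply/eqP; rewrite eqn_dvd !dvdn_gcd !dvdn_gcdl /=; apply/andP; split.
    by rewrite -(dvdn_subr nK) ?dvdn_gcdr // (dvdn_trans (dvdn_gcdl _ _)).
  by rewrite dvdn_sub ?dvdn_gcdr // (dvdn_trans (dvdn_gcdl _ _)).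
have g0 : (0 < gcdn k' n)%N by rewrite gcdn_gt0 k'0.
have [q Lq] : exists q, L = (q * gcdn k' n)%N.
  by exists (L %/ gcdn k' n)%N; rewrite divnK // (dvdn_trans (dvdn_gcdl _ _)).
have tE : ((K - n) %/ gcdn k' n + n %/ gcdn k' n = 4 * q)%N.
  by rewrite -divnDr ?dvdn_gcdr // subnK // /K {1}Lq mulnA mulnK.
apply: sum_factor_eq; rewrite ?gE //.
- by clear -on nK; lia.
- by move: tE; move: (_ %/ _)%N (_ %/ _)%N => a b tE; clear -tE; lia.
- by move: tE; move: (_ %/ _)%N (_ %/ _)%N => a b tE; clear -tE; lia.
Qed.

(** This is the weight w, with [L] = km. The order of the subtraction absorbs the minus sign of the
    character sums. *)
Definition factor_diff (n : nat) : int :=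
  if odd n then 0 else sum_factor p L n - sum_factor p k n.

Let X := (p ^ L./2)%N.

Let k_half : (k <= L./2)%N.
Proof. by move: k_lt_L kL => + /dvdnP[[|[|q]] E]; rewrite E; nia. Qed.

Let bound (r : nat) : int := if (4 %| r)%N then X%:Z - 1 else if odd r then 0 else 2.

(** If r is even but not divisible by 4, neither is r / gcd(k', r), and both factors are 1 or -1. If
    4 divides r, both lie between 1 and [X]: either the gcd is at most L / 2, or it is [L], and then
    r / L < 4 makes the factor 1. *)
Let factor_diff_bound r : (0 < r < K)%N -> `|factor_diff r| <= bound r.
Proof.
move=> /andP[r0 rK]; rewrite /factor_diff /bound.
have L0 : (0 < L)%N by apply: leq_trans k_lt_L.
have tE k' : (r = r %/ gcdn k' r * gcdn k' r)%N by rewrite divnK ?dvdn_gcdr.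
case: ifP => odd_r.
  by case: ifP => [r4|_]; [move: odd_r r4; lia | rewrite normr0].
have [r4|r4] := boolP (4 %| r)%N; last first.
  have small k' : `|sum_factor p k' r| <= 1.
    rewrite /sum_factor; case: ifP => _; first by rewrite normrX normrN1 expr1n.
    by case: ifP => // /dvdnP[q Eq]; move: r4; rewrite {1}(tE k') Eq mulnAC dvdn_mull.
  by have := small k; have := small L; lia.
have X1 : (0 < X)%N by rewrite expn_gt0; lia.
have powX m : (m <= L./2)%N -> (0 < p ^ m <= X)%N.
  by move=> mL; rewrite expn_gt0 leq_pexp2l //; lia.
have small k' : (gcdn k' r <= L./2)%N -> 1 <= sum_factor p k' r <= X%:Z.
  move=> k'L; rewrite /sum_factor; case: ifP => _.
    by rewrite (_ : odd r./2 = false) /=; [rewrite expr0; lia | move: r4; lia].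
  by case: ifP => _; have := powX _ k'L; lia.
have gk : (gcdn k r <= L./2)%N by apply: leq_trans (dvdn_leq k_gt0 (dvdn_gcdl _ _)) k_half.
have := small k gk; have [gL|gL] := leqP (gcdn L r) L./2; first by have := small L gL; lia.
have {}gL : gcdn L r = L.
  move: (dvdn_gcdl L r) gL L0; move: (gcdn L r) => g /dvdnP[[|[|q]] E] gL L0.
  - by move: L0; rewrite E.
  - by rewrite E mul1n.
  by have : (2 * g <= L)%N; [rewrite E leq_mul2r orbT | clear -gL; lia].
have E1 : sum_factor p L r = 1.
  rewrite /sum_factor gL; case: ifP => _.
    by rewrite (_ : odd r./2 = false) //; move: r4; lia.
  case: ifP => // /dvdnP[q Eq]; have := tE L; rewrite gL Eq => rE.
  by move: rK r0; rewrite rE /K; case: (q) => [|q']; nia.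
by rewrite E1; lia.
Qed.

Let sum_bound m : \sum_(0 <= r < 4 * m) bound r = m%:Z * (X%:Z + 1).
Proof.
elim: m => [|m IH]; first by rewrite muln0 big_geq.
rewrite mulnS !addSn !add0n !big_nat_recr ?IH //=.
have b i : bound (4 * m + i)%N = bound i.
  by rewrite /bound dvdn_addr ?dvdn_mulr // oddD oddM.
have := (b 0, b 1, b 2, b 3)%N; rewrite addn0 addn1 addn2 addn3 => -[[[-> ->] ->] ->].
rewrite {b IH}/bound /=; clear; move: X => Y; lia.
Qed.

(** Since X >= 2h + 1 for h the integer part of L / 2, X exceeds [L] if [L] is even and is at least
    [L] if [L] is odd, while p^L is X^2 or p X^2 respectively. *)
Let large : (L * (X + 1) < p ^ L)%N.
Proof.
have big h : (2 * h + 1 <= p ^ h)%N.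
  by elim: h => // h IH; rewrite expnS; nia.
have XE : (p ^ L = p ^ (odd L) * (X * X))%N.
  by rewrite -expnD addnn -expnD odd_double_half.
have := big L./2; rewrite XE -/X; have := odd_double_half L.
by case: (odd L) => /=; rewrite ?expn0 ?expn1; move: k_lt_L k_gt0; nia.
Qed.

Lemma factor_diff_effective_lt : effective (fun n => (factor_diff n)%:~R).
Proof.
have L0 : (0 < L)%N by apply: leq_trans k_lt_L.
have oddK n : odd (n %% K) = odd n.
  by rewrite {2}(divn_eq n K) oddD oddM /K oddM andbF.
apply: (@effective_periodic K) => [|n|n nK|].
- by rewrite /K; lia.
- by rewrite /factor_diff oddK; case: ifP => // /negbT on; rewrite !sum_factor_mod.
- rewrite /factor_diff oddB // {1}/K oddM /=.
  by case: ifP => // /negbT on; rewrite !sum_factor_opp.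
have D0 : factor_diff 0 = (p ^ L)%:Z - (p ^ k)%:Z.
  by rewrite /factor_diff /sum_factor /= !gcdn0 !div0n /=.
apply: (@le_trans _ _ (\sum_(1 <= r < K) bound r)).
  by apply: ler_sum_nat => r /factor_diff_bound.
(* The total L (X + 1) includes the term X - 1 at r = 0. Removing it leaves the room needed for p^k,
   which is at most [X]. *)
have := sum_bound L; rewrite big_ltn -/K ?/K ?muln_gt0 ?L0 // D0.
have pk : (p ^ k <= X)%N by rewrite leq_pexp2l //; lia.
rewrite {1}/bound dvdn0; move: large pk; move: (\sum_(1 <= r < _) _) => S; lia.
Qed.

End Dominated.

Lemma factor_diff_effective (p k L : nat) :
  (2 < p)%N -> (0 < k)%N -> (k %| L)%N -> (0 < L)%N ->
  effective (fun n => (factor_diff p k L n)%:~R).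
Proof.
move=> p2 k0 kL L0; have := dvdn_leq L0 kL; rewrite leq_eqVlt => /orP[/eqP <-|ltkL].
  apply: effective_ext (effective_nonneg (lexx 0)) => n _.
  by rewrite /factor_diff subrr; case: ifP.
exact: factor_diff_effective_lt.
Qed.

(** * Power maps and traces in finite fields *)

Section PowerMaps.
Variable F : finFieldType.
Let N := #|F|.-1.

Let N_gt0 : (0 < N)%N.
Proof. by rewrite /N; have := finNzRing_gt1 F; case: #|F| => [|[]]. Qed.

Lemma finField_expN (x : F) : x != 0 -> x ^+ N = 1.
Proof.
move=> x0; apply: (mulfI x0); rewrite -exprS mulr1 /N prednK ?expf_card //.
exact: ltnW (finNzRing_gt1 F).
Qed.

Lemma finField_prim_root : exists g : F, N.-primitive_root g.
Proof.
have /hasP[g _ gN] : has N.-primitive_root (rem 0 (enum F)); last by exists g.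
apply: has_prim_root => //.
- apply/allP=> x; rewrite mem_rem_uniq ?enum_uniq // inE => /andP[x0 _].
  by rewrite unity_rootE finField_expN.
- by rewrite rem_uniq ?enum_uniq.
- by rewrite size_rem ?mem_enum // -cardE leqnn.
Qed.

(** Writing x = g^i for a generator g, the hypothesis says that [D] divides i. *)
Lemma finField_exists_root (D : nat) (x : F) :
  (D %| N)%N -> x ^+ (N %/ D) = 1 -> exists2 y, y != 0 & y ^+ D = x.
Proof.
move=> DN xD; have [g gN] := finField_prim_root.
have D0 : (0 < D)%N by apply: dvdn_gt0 DN.
have ND0 : (0 < N %/ D)%N by rewrite divn_gt0 // dvdn_leq.
have xN : x ^+ N = 1 by rewrite -(divnK DN) exprM xD expr1n.
have [i xE] := prim_rootP gN xN.
have : (N %| i * (N %/ D))%N by rewrite (prim_order_dvd gN) exprM -xE xD.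
rewrite -{1}(divnK DN) mulnC dvdn_pmul2r // => Di.
exists (g ^+ (i %/ D)); last by rewrite -exprM divnK.
by rewrite expf_eq0 (prim_root_eq0 gN) gtn_eqF ?andbF.
Qed.

Lemma finField_card_unity_root (D : nat) :
  (D %| N)%N -> #|[set z : F | z ^+ D == 1]| = D.
Proof.
move=> DN; have [g gN] := finField_prim_root.
have D0 : (0 < D)%N by apply: dvdn_gt0 DN.
have gD : D.-primitive_root (g ^+ (N %/ D)) by rewrite dvdn_prim_root.
have -> : [set z : F | z ^+ D == 1] = [set (g ^+ (N %/ D)) ^+ (i : 'I_D) | i in 'I_D].
  apply/setP=> z; rewrite inE; apply/eqP/imsetP => [zD|[i _ ->]].
    by have [i ->] := prim_rootP gD zD; exists i.
  by rewrite exprAC (prim_expr_order gD) expr1n.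
rewrite card_imset ?card_ord // => i j /eqP.
by rewrite (eq_prim_root_expr gD) !modn_small // => /eqP/val_inj.
Qed.

Lemma finField_card_fiber (D : nat) (y : F) : y != 0 ->
  #|[set x : F | x ^+ D == y ^+ D]| = #|[set x : F | x ^+ D == 1]|.
Proof.
move=> y0; rewrite -[RHS](card_imset _ (mulIf y0)); apply: eq_card => x.
rewrite inE; apply/eqP/imsetP => [xy|[z + ->]].
  by exists (x / y); rewrite ?divfK // inE expr_div_n xy divff ?expf_neq0.
by rewrite inE exprMn => /eqP->; rewrite mul1r.
Qed.

Lemma finField_card_root (D : nat) (v : F) : (D %| N)%N -> v != 0 ->
  #|[set x : F | x ^+ D == v]| = if v ^+ (N %/ D) == 1 then D else 0%N.
Proof.
move=> DN v0; case: eqP => [/(finField_exists_root DN)[y y0 <-]|vD].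
  by rewrite finField_card_fiber ?finField_card_unity_root.
apply/eqP; rewrite cards_eq0; apply/eqP/setP=> x; rewrite !inE; apply/eqP => xv.
apply: vD; rewrite -xv -exprM mulnC divnK // finField_expN //.
by apply: contraNneq v0 => x0; rewrite -xv x0 expr0n gtn_eqF //; apply: dvdn_gt0 DN.
Qed.

Lemma card_sum_fiber (T U : finType) (h : T -> U) (P : pred U) :
  #|[set x | P (h x)]| = (\sum_(v | P v) #|[set x | h x == v]|)%N.
Proof.
rewrite -sum1dep_card (partition_big h P) //=; apply: eq_bigr => v Pv.
rewrite -sum1dep_card; apply: eq_bigl => x.
by case: eqP => [->|_]; rewrite ?Pv ?andbF.
Qed.

(** By Bezout, the [A]-th powers and the powers of exponent gcd(A, N) form the same subset of the
    cyclic group of units, and both maps have the same kernel, hence fibers of the same size. *)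
Lemma finField_card_pow_gcd (A : nat) (P : pred F) : (0 < A)%N ->
  #|[set x : F | P (x ^+ A)]| = #|[set x : F | P (x ^+ gcdn A N)]|.
Proof.
move=> A0; set G := gcdn A N.
have G0 : (0 < G)%N by rewrite gcdn_gt0 A0.
rewrite (card_sum_fiber (fun x => x ^+ A)) (card_sum_fiber (fun x => x ^+ G)).
apply: eq_bigr => v _; have [->|v0] := eqVneq v 0.
  by apply: eq_card => x; rewrite !inE !expf_eq0 A0 G0.
have [s t E _] := egcdnP N A0; rewrite -/G in E.
have powG (y : F) : y != 0 -> y ^+ G = (y ^+ s) ^+ A.
  move=> y0; rewrite -exprM E exprD [(t * N)%N]mulnC exprM (finField_expN y0).
  by rewrite expr1n mul1r.
have powA (y : F) : y ^+ A = (y ^+ (A %/ G)) ^+ G by rewrite -exprM divnK ?dvdn_gcdl.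
have nz D (y : F) : (0 < D)%N -> y ^+ D = v -> y != 0.
  by move=> D0 yv; apply: contraNneq v0 => y0; rewrite -yv y0 expr0n gtn_eqF.
have [/existsP[y /eqP yA]|noA] := boolP [exists y, y ^+ A == v].
  have y0 := nz _ _ A0 yA; rewrite -{1}yA finField_card_fiber //.
  rewrite -yA powA finField_card_fiber ?expf_neq0 //; apply: eq_card => x; rewrite !inE.
  apply/eqP/eqP => [xA|xG]; last by rewrite -(divnK (dvdn_gcdl A N)) mulnC exprM xG expr1n.
  have x0 : x != 0 by apply: contra_eqN xA => /eqP->; rewrite expr0n gtn_eqF // eq_sym oner_eq0.
  by rewrite powG // exprAC xA expr1n.
have -> : [set x | x ^+ A == v] = set0.
  apply/setP=> x; rewrite !inE; apply: contraNF noA => xv.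
  by apply/existsP; exists x.
have -> // : [set x | x ^+ G == v] = set0.
apply/setP=> x; rewrite !inE; apply: contraNF noA => /eqP xv.
by apply/existsP; exists (x ^+ s); rewrite -powG ?xv // (nz G).
Qed.

Lemma dvdn_finField_card_root (D : nat) (v : F) : (D %| N)%N -> v != 0 ->
  (D %| #|[set x : F | x ^+ D == v]|)%N.
Proof. by move=> DN v0; rewrite finField_card_root //; case: ifP. Qed.

End PowerMaps.

(** * Fibers of additive maps *)

Section Additive.
Variable F : finFieldType.
Implicit Types (V : {set F}) (phi : F -> F).

Lemma card_fiber_le V phi (t : F) :
  {in V &, forall x y, x - y \in V} -> (forall x y, phi (x - y) = phi x - phi y) ->
  (#|[set x in V | phi x == t]| <= #|[set x in V | phi x == 0%R]|)%N.
Proof.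
move=> VB phiB; have [->|[y]] := set_0Vmem [set x in V | phi x == t]; first by rewrite cards0.
rewrite inE => /andP[yV /eqP yt]; rewrite -(card_imset _ (addIr (- y))).
apply: subset_leq_card; apply/subsetP=> _ /imsetP[x + ->]; rewrite !inE => /andP[xV /eqP xt].
by rewrite VB // phiB xt yt subrr eqxx.
Qed.

(** No fiber is larger than the kernel, and there are at most #|S| fibers. *)
Lemma card_le_ker V (S : {set F}) phi :
  {in V &, forall x y, x - y \in V} -> (forall x y, phi (x - y) = phi x - phi y) ->
  {in V, forall x, phi x \in S} ->
  (#|V| <= #|S| * #|[set x in V | phi x == 0%R]|)%N.
Proof.
move=> VB phiB phiS; rewrite -sum1_card (partition_big phi (mem S)) //= -sum_nat_const.
apply: leq_sum => t _; apply: leq_trans (card_fiber_le t VB phiB).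
by rewrite -sum1dep_card leq_eqVlt; apply/orP; left; apply/eqP; apply: eq_bigl => x.
Qed.

Lemma card_fiber_eq phi (y : F) : (forall x y, phi (x - y) = phi x - phi y) ->
  #|[set x | phi x == phi y]| = #|[set x | phi x == 0]|.
Proof.
move=> phiB; rewrite -(card_imset _ (addIr (- y))); apply: eq_card => z.
rewrite [RHS]inE; apply/imsetP/eqP => [[x + ->]|z0].
  by rewrite inE phiB => /eqP->; rewrite subrr.
by exists (z + y); rewrite ?addrK // inE -subr_eq0 -phiB addrK z0.
Qed.

End Additive.

Lemma card_set_pair (T U : finType) (P : T -> U -> bool) :
  #|[set z : T * U | P z.1 z.2]| = (\sum_x #|[set y | P x y]|)%N.
Proof.
rewrite -sum1dep_card -(pair_big_dep xpredT P (fun _ _ => 1%N)) /=.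
by apply: eq_bigr => x _; rewrite sum1dep_card.
Qed.

(** * Absolute trace and Artin-Schreier equations *)

Section Trace.
Variables (F : finFieldType) (p n : nat).
Hypotheses (pF : p \in [pchar F]) (cF : #|F| = (p ^ n)%N).

Let pr_p : prime p. Proof. by case/andP: pF. Qed.
Let p_gt0 : (0 < p)%N. Proof. exact: prime_gt0. Qed.
Let p_gt1 : (1 < p)%N. Proof. exact: prime_gt1. Qed.

Let n_gt0 : (0 < n)%N.
Proof. by have := finNzRing_gt1 F; rewrite cF; case: n. Qed.

Lemma frobD d (x y : F) : (x + y) ^+ (p ^ d) = x ^+ (p ^ d) + y ^+ (p ^ d).
Proof. by apply: exprDn_pchar; rewrite (eq_pnat _ (pcharf_eq pF)) pnatX pnat_id. Qed.

Lemma frobN d (x : F) : (- x) ^+ (p ^ d) = - x ^+ (p ^ d).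
Proof. by apply: exprNn_pchar; rewrite (eq_pnat _ (pcharf_eq pF)) pnatX pnat_id. Qed.

Lemma frobB d (x y : F) : (x - y) ^+ (p ^ d) = x ^+ (p ^ d) - y ^+ (p ^ d).
Proof. by rewrite frobD frobN. Qed.

(** The absolute trace, with values kept in [F]: elements of the prime field occur throughout as
    solutions of c^p = c. *)
Definition trp (x : F) : F := \sum_(i < n) x ^+ (p ^ i).

Lemma trpB x y : trp (x - y) = trp x - trp y.
Proof. by rewrite -sumrB; apply: eq_bigr => i _; rewrite frobB. Qed.

Lemma trp0 : trp 0 = 0.
Proof. by have := trpB 0 0; rewrite !subrr. Qed.

Lemma trpN x : trp (- x) = - trp x.
Proof. by rewrite -sub0r trpB trp0 sub0r. Qed.

Lemma trpD x y : trp (x + y) = trp x + trp y.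
Proof. by rewrite -{1}[y]opprK trpB trpN opprK. Qed.

Lemma trp_frob1 x : trp (x ^+ p) = trp x.
Proof.
rewrite /trp; case: n cF => [|m] c; first by rewrite !big_ord0.
rewrite big_ord_recr big_ord_recl /= addrC; congr (_ + _).
  by rewrite -exprM -expnS -c expf_card expn0 expr1.
by apply: eq_bigr => i _; rewrite -exprM -expnS.
Qed.

Lemma trp_frob d x : trp (x ^+ (p ^ d)) = trp x.
Proof.
by elim: d => [|d IH]; rewrite ?expn0 ?expr1 // expnS mulnC exprM trp_frob1.
Qed.

Lemma trp_expp x : trp x ^+ p = trp x.
Proof.
have E m : (\sum_(i < m) x ^+ (p ^ i)) ^+ p = \sum_(i < m) (x ^+ p) ^+ (p ^ i).
  elim: m => [|m IH]; first by rewrite !big_ord0 expr0n gtn_eqF.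
  rewrite !big_ord_recr /= -[X in _ ^+ X](expn1 p) frobD expn1 IH; congr (_ + _).
  by rewrite exprAC.
by rewrite /trp E -/(trp _) trp_frob1.
Qed.

Lemma fixed_frob d (c : F) : c ^+ p = c -> c ^+ (p ^ d) = c.
Proof. by move=> cp; elim: d => [|d IH]; rewrite ?expn0 ?expr1 // expnS exprM cp. Qed.

Lemma trpZ c x : c ^+ p = c -> trp (c * x) = c * trp x.
Proof.
by move=> cp; rewrite mulr_sumr; apply: eq_bigr => i _; rewrite exprMn (fixed_frob i cp).
Qed.

Lemma trp_const c : c ^+ p = c -> trp c = n%:R * c.
Proof.
move=> cp; rewrite /trp (eq_bigr (fun=> c)) => [|i _]; last exact: fixed_frob.
by rewrite sumr_const card_ord mulr_natl.
Qed.

Lemma dvdn_pred_card d : (d %| n)%N -> ((p ^ d).-1 %| #|F|.-1)%N.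
Proof. by case/dvdnP=> q nE; rewrite cF nE mulnC expnM dvdn_pred_predX. Qed.

Let Fp := [set t : F | t ^+ p == t].

Lemma card_prime_subfield : #|Fp| = p.
Proof.
have /(finField_card_unity_root (F := F)) : (p.-1 %| #|F|.-1)%N.
  by rewrite -[p in p.-1]expn1 dvdn_pred_card ?dvd1n.
move=> h; rewrite -[RHS](prednK p_gt0) -[X in _ = X.+1]h {h}.
rewrite (cardsD1 0) inE expr0n gtn_eqF // eqxx add1n; congr _.+1.
apply: eq_card => t; rewrite !inE; have [->|t0] /= := eqVneq t 0.
  by rewrite expr0n gtn_eqF -?subn1 ?subn_gt0 // eq_sym oner_eq0.
by rewrite -[in LHS](prednK p_gt0) exprS -[X in _ == X]mulr1 (inj_eq (mulfI t0)).
Qed.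

(** The degree p^(n-1) of the trace polynomial bounds the kernel from above; the trace having at
    most p values bounds it from below. *)
Lemma card_trp_eq0 : #|[set x | trp x == 0]| = (p ^ n.-1)%N.
Proof.
apply/eqP; rewrite eqn_leq; apply/andP; split.
  pose P : {poly F} := \sum_(i < n) 'X^(p ^ i).
  have sP m : size (\sum_(i < m.+1) 'X^(p ^ i) : {poly F}) = (p ^ m).+1.
    elim: m => [|m IH]; first by rewrite big_ord1 expn0 size_polyX.
    by rewrite big_ord_recr /= addrC size_polyDl size_polyXn // IH ltnS ltn_exp2l.
  have {}sP : size P = (p ^ n.-1).+1 by have := sP n.-1; rewrite prednK.
  rewrite -ltnS -sP cardE; apply: max_poly_roots; rewrite ?enum_uniq //.
    by rewrite -size_poly_gt0 sP.
  apply/allP=> x; rewrite mem_enum inE => /eqP tx.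
  by rewrite rootE horner_sum -[X in _ == X]tx; apply/eqP/eq_bigr => i _; rewrite hornerXn.
have := @card_le_ker F setT Fp trp; rewrite card_prime_subfield cardsT cF -[in (p ^ n)%N](prednK n_gt0).
rewrite expnS leq_pmul2l // => /(_ _ trpB) H.
apply: leq_trans (H _ _) _ => [x y _ _|x _|]; rewrite ?inE ?trp_expp //.
by apply: subset_leq_card; apply/subsetP=> x; rewrite !inE.
Qed.

(** The kernel is not all of [F], so by scaling the trace attains every [t] of the prime field, and
    each fiber is a translate of the kernel. *)
Lemma card_trp (t : F) : t ^+ p = t -> #|[set x | trp x == t]| = (p ^ n.-1)%N.
Proof.
move=> tp; have [x0 x0n] : exists x, trp x != 0.
  have [/existsP//|] := boolP [exists x, trp x != 0]; rewrite negb_exists => /forallP all0.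
  have : (#|[set x | trp x == 0%R]| < #|F|)%N.
    by rewrite card_trp_eq0 cF ltn_exp2l // prednK.
  rewrite (_ : [set x | _] = setT) ?cardsT ?ltnn //; apply/setP=> x.
  by rewrite !inE -[_ == _]negbK all0.
rewrite -card_trp_eq0 -(card_fiber_eq (t / trp x0 * x0) trpB) trpZ ?divfK //.
by rewrite expr_div_n tp trp_expp.
Qed.

(** The map y^p - y has the prime field as kernel and takes values of trace 0. By counting, it
    attains all of them. *)
Lemma card_artin_schreier (w : F) :
  #|[set y : F | y ^+ p - y == w]| = if trp w == 0 then p else 0%N.
Proof.
pose phi (y : F) := y ^+ p - y.
have phiB x y : phi (x - y) = phi x - phi y.
  by have := frobB 1 x y; rewrite /phi expn1 => ->; ring.
have kerphi : #|[set y | phi y == 0]| = p.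
  by rewrite -card_prime_subfield; apply: eq_card => y; rewrite !inE subr_eq0.
have trphi y : trp (phi y) = 0 by rewrite trpB trp_frob1 subrr.
have imE : [set phi y | y in F] = [set x | trp x == 0].
  apply/eqP; rewrite eqEcard; apply/andP; split.
    by apply/subsetP=> _ /imsetP[y _ ->]; rewrite inE trphi.
  have := @card_le_ker F setT [set phi y | y in F] phi _ phiB.
  rewrite cardsT cF card_trp_eq0 -[in (p ^ n)%N](prednK n_gt0) expnSr.
  rewrite (_ : #|[set x in setT | phi x == 0]| = p); last first.
    by rewrite -kerphi; apply: eq_card => x; rewrite !inE.
  rewrite leq_pmul2r // => H; apply: H => x; first by move=> ? ? _; rewrite inE.
  by rewrite imset_f.
have [tw|tw] := eqVneq (trp w) 0.
  have : w \in [set phi y | y in F] by rewrite imE inE tw.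
  by case/imsetP=> y _ ->; rewrite -[RHS]kerphi -(card_fiber_eq y phiB).
apply/eqP; rewrite cards_eq0; apply/eqP/setP=> y; rewrite !inE.
by apply: contraNF tw => /eqP <-; rewrite -/(phi y) trphi.
Qed.

Lemma card_artin_schreier_curve (g : F -> F) :
  #|[set P : F * F | P.2 ^+ p - P.2 == g P.1]| = (p * #|[set x | trp (g x) == 0%R]|)%N.
Proof.
rewrite (card_set_pair (fun x y => y ^+ p - y == g x)) -[in RHS]sum1dep_card big_distrr [RHS]big_mkcond.
by apply: eq_bigr => x _; rewrite card_artin_schreier /= muln1.
Qed.

End Trace.

(** * Distribution of the forms x^(p^d + 1) *)

Lemma odd_pow_mod4 (p m : nat) :
  odd p -> (p ^ m %% 4 == 3)%N = odd m && (p %% 4 == 3)%N.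
Proof.
move=> odd_p; have pc : (p %% 4 = 1 \/ p %% 4 = 3)%N by lia.
elim: m => [|m IH]; first by rewrite expn0.
have ac : (p ^ m %% 4 = 1 \/ p ^ m %% 4 = 3)%N.
  have : odd (p ^ m) by rewrite oddX odd_p orbT.
  by move: (p ^ m)%N => a; clear; lia.
rewrite expnS -modnMm.
by case: pc IH => ->; case: ac => ->; rewrite /=; case: (odd m).
Qed.

Section Forms.
Variables (F : finFieldType) (p n : nat).
Hypotheses (pF : p \in [pchar F]) (cF : #|F| = (p ^ n)%N) (odd_p : odd p).

Let pr_p : prime p. Proof. by case/andP: pF. Qed.
Let p_gt0 : (0 < p)%N. Proof. exact: prime_gt0. Qed.
Let p_gt1 : (1 < p)%N. Proof. exact: prime_gt1. Qed.
Let p_gt2 : (2 < p)%N. Proof. by move: p_gt1 odd_p; case: p => [|[|[]]]. Qed.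
Let n_gt0 : (0 < n)%N.
Proof. by have := finNzRing_gt1 F; rewrite cF; case: n. Qed.
Let pnE : (p ^ n = p * p ^ n.-1)%N.
Proof. by rewrite -expnS prednK. Qed.

Let two_neq0 : 2%:R != 0 :> F.
Proof.
apply/negP; rewrite -(dvdn_pcharf pF) => /(dvdn_leq (isT : 0 < 2)%N).
by rewrite leqNgt p_gt2.
Qed.

Let self_opp0 (x : F) : x = - x -> x = 0.
Proof.
move=> xx; apply: (mulfI two_neq0); rewrite mulr0 mulr_natl mulr2n {2}xx subrr.
by [].
Qed.

Let N1_neq1 : -1 != 1 :> F.
Proof. by apply: contraNneq (oner_neq0 F) => e; apply/eqP/self_opp0. Qed.

Local Notation tr := (@trp F p n).
Local Notation M h t := #|[set x : F | tr (h x) == t]|.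

(* The number of solutions of tr (h x) = t when all the character sums of
   c (h x), c in F_p^*, are equal to S. *)
Definition trp_dist (h : F -> F) (S : int) : Prop :=
  forall t : F, t ^+ p = t ->
  p%:Z * (M h t)%:Z = (p ^ n)%:Z + ((p * (t == 0%R))%:Z - 1) * S.

Let exp0p : 0 ^+ p = 0 :> F. Proof. by rewrite expr0n gtn_eqF. Qed.

Let sum_fp (G : F -> nat) :
  (forall t, t ^+ p = t -> t != 0 -> G t = G 1) ->
  (\sum_(t | t ^+ p == t) G t = G 0%R + p.-1 * G 1%R)%N.
Proof.
move=> G1; rewrite (bigD1 0) ?exp0p //=; congr (_ + _)%N.
rewrite (eq_bigr (fun=> G 1)) => [|t /andP[/eqP tp t0]]; last exact: G1.
rewrite sum_nat_cond_const; congr (_ * _)%N.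
transitivity #|[set t : F | t ^+ p == t]|.-1; last by rewrite (card_prime_subfield pF cF).
rewrite [in RHS](cardsD1 0) inE exp0p eqxx /=.
by apply: eq_card => t; rewrite !inE andbC.
Qed.

Let sum_M (h : F -> F) : (\sum_(t | t ^+ p == t) M h t = p ^ n)%N.
Proof.
rewrite -(card_sum_fiber (fun x => tr (h x)) (fun t => t ^+ p == t)) -cF -cardsT.
by apply: eq_card => x; rewrite !inE trp_expp ?eqxx.
Qed.

Let scale_M (h : F -> F) :=
  forall c, c ^+ p = c -> c != 0 -> forall t, M h (c * t) = M h t.

Let M_const (h : F -> F) : scale_M h ->
  forall t, t ^+ p = t -> t != 0 -> M h t = M h 1%R.
Proof. by move=> hs t tp t0; rewrite -{1}[t]mulr1 hs. Qed.

(** The counts at the p - 1 nonzero values are equal and all counts add up to p^n, so M(0) - M(1)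
    determines them. *)
Lemma trp_dist_scale (h : F -> F) : scale_M h -> trp_dist h ((M h 0%R)%:Z - (M h 1%R)%:Z).
Proof.
move=> hs t tp; have := sum_M h; rewrite sum_fp; last exact: M_const.
have [->|t0] := eqVneq t 0; last rewrite (M_const hs tp t0).
  by move: (M h 0%R) (M h 1%R) p_gt0 => a b; clear; case: p => // q _ <-;
    rewrite /= muln1 PoszD PoszM; lia.
by move: (M h 0%R) (M h 1%R) p_gt0 => a b; clear; case: p => // q _ <-;
    rewrite /= muln0 PoszD PoszM; lia.
Qed.

(** Under this condition some substitution x -> mu x multiplies the form by any prescribed nonzero c
    of the prime field. *)
Let norm_surj d := forall c : F, c ^+ p = c -> c != 0 -> exists mu, mu ^+ (p ^ d + 1) = c.

Let scale_form d : norm_surj d -> scale_M (fun x => x ^+ (p ^ d + 1)).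
Proof.
move=> ns c cp c0 t; have [mu muc] := ns c cp c0.
have mu0 : mu != 0.
  by apply: contraNneq c0 => mu0; rewrite -muc mu0 expr0n addn1.
rewrite -(card_preimset _ (mulfI mu0)); apply: eq_card => x; rewrite !inE.
by rewrite exprMn muc trpZ // (inj_eq (mulfI c0)).
Qed.

(** Up to Frobenius, the increment of the form is the trace of x^(p^d) (z + z^(p^(2d))) plus a
    constant. It vanishes identically if z is in the radical; otherwise x^(p^d) a runs over [F] and
    the trace is equidistributed. *)
Let card_shift d (z : F) :
  #|[set x | tr ((x + z) ^+ (p ^ d + 1)) == tr (x ^+ (p ^ d + 1))]| =
  if z ^+ (p ^ (d + d)) == - z then (p ^ n)%N else (p ^ n.-1)%N.
Proof.
have hE x : tr ((x + z) ^+ (p ^ d + 1)) = tr (x ^+ (p ^ d + 1)) +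
    (tr (x ^+ (p ^ d) * (z + z ^+ (p ^ (d + d)))) + tr (z ^+ (p ^ d + 1))).
  have -> : (x + z) ^+ (p ^ d + 1) = x ^+ (p ^ d + 1) +
      (x ^+ (p ^ d) * z + z ^+ (p ^ d) * x + z ^+ (p ^ d + 1)).
    by rewrite addn1 !exprSr frobD //; ring.
  rewrite mulrDr !(trpD n pF); congr (_ + (_ + _ + _)).
  by rewrite -(trp_frob cF d (z ^+ _ * _)) exprMn -exprM -expnD mulrC.
case: eqP => [zW|/eqP zW].
  rewrite -cF -cardsT; apply: eq_card => x; rewrite !inE hE zW subrr mulr0 (trp0 n pF) add0r.
  have -> : tr (z ^+ (p ^ d + 1)) = 0; last by rewrite addr0 eqxx.
  (* Frobenius turns z^(p^d + 1) into its negative on the radical, so its trace is its own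
     opposite. *)
  apply: self_opp0; rewrite -(trpN n pF) -{1}(trp_frob cF d) addn1; congr (tr _).
  by rewrite [in LHS]exprS exprMn -exprM -expnD zW mulrN -exprSr.
have a0 : z + z ^+ (p ^ (d + d)) != 0 by rewrite addrC addr_eq0.
set a := z + _ in a0 hE.
have inj : injective (fun x : F => x ^+ (p ^ d) * a).
  move=> x y /(mulIf a0) /eqP; rewrite -subr_eq0 -(frobB pF) expf_eq0 subr_eq0.
  by case/andP=> _ /eqP.
have tp : (- tr (z ^+ (p ^ d + 1))) ^+ p = - tr (z ^+ (p ^ d + 1)).
  by rewrite -[p in LHS]expn1 (frobN pF) expn1 (trp_expp pF cF).
rewrite -(card_trp pF cF tp) -[RHS](card_preimset _ inj); apply: eq_card => x.
by rewrite !inE hE -[X in _ == X]addr0 (inj_eq (addrI _)) addr_eq0.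
Qed.

(** The pairs (x, z) for which x + z and x give the form the same value are counted twice: for fixed
    z by [card_shift], and by values as the sum of the squares of the counts. *)
Lemma form_square d (h := fun x : F => x ^+ (p ^ d + 1)) : norm_surj d ->
  ((M h 0%R)%:Z - (M h 1%R)%:Z) ^+ 2 =
  (#|[set z : F | z ^+ (p ^ (d + d)) == - z]| * p ^ n)%:Z.
Proof.
move=> /scale_form ns; set W := #|[set z | z ^+ (p ^ (d + d)) == - z]|.
have pairs : (\sum_(x : F) M h (tr (h x)) = p ^ n.-1 * p ^ n + W * (p ^ n - p ^ n.-1))%N.
  have cardE (P : pred F) : #|[set x | P x]| = (\sum_x P x)%N.
    by rewrite -sum1dep_card big_mkcond; apply: eq_bigr => x _; case: (P x).
  transitivity (\sum_(z : F) #|[set x | tr (h (x + z)%R) == tr (h x)]|)%N.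
    under eq_bigr => x _ do rewrite -(card_preimset _ (addrI x)) cardE.
    under [RHS]eq_bigr => z _ do rewrite cardE.
    by rewrite exchange_big /=; apply: eq_bigr => z _; apply: eq_bigr => x _; rewrite inE.
  transitivity (\sum_(z : F) (p ^ n.-1 + (z ^+ (p ^ (d + d)) == - z)%R * (p ^ n - p ^ n.-1)))%N.
    apply: eq_bigr => z _; rewrite card_shift; case: eqP => _; last by rewrite mul0n addn0.
    by rewrite mul1n subnKC // leq_exp2l // leq_pred.
  rewrite big_split /= sum_nat_const cF mulnC; congr (_ + _)%N.
  by rewrite -big_distrl /W cardE.
have squares : (\sum_(x : F) M h (tr (h x)) = M h 0%R ^ 2 + p.-1 * M h 1%R ^ 2)%N.
  rewrite -(sum_fp (G := fun t => M h t ^ 2)%N); last first.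
    by move=> t tp t0; rewrite (M_const ns tp t0).
  rewrite (partition_big (fun x => tr (h x)) (fun t => t ^+ p == t)) /= => [|x _]; last first.
    by rewrite (trp_expp pF cF).
  apply: eq_bigr => t _; rewrite (eq_bigr (fun=> M h t)) => [|x /eqP-> //].
  by rewrite sum_nat_cond_const.
have total := sum_M h; rewrite sum_fp in total; last exact: M_const.
rewrite pairs {pairs} in squares; move: total squares; rewrite pnE.
have Qge : (p ^ n.-1 <= p * p ^ n.-1)%N by rewrite leq_pmull.
move: (p ^ n.-1)%N (M h 0%R) (M h 1%R) Qge => Q a b Qge; move: W => w.
have [q pE] : exists q, p = q.+1 by exists p.-1; rewrite prednK.
have q0 : q%:Z != 0 by move: p_gt1; rewrite pE; clear; lia.
rewrite {}pE /= => /(congr1 Posz) E1 /(congr1 Posz) E2.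
move: E1 E2; rewrite mulSn addKn !(PoszD, PoszM) => E1 E2.
apply: (mulfI q0).
(* With q = p - 1, this recovers (a - b)^2 from the sum and the sum of squares of the counts a, b,
   ..., b. *)
have -> : q%:Z * (a%:Z - b%:Z) ^+ 2 =
    (1 + q%:Z) * (a%:Z * a%:Z + q%:Z * (b%:Z * b%:Z)) - (a%:Z + q%:Z * b%:Z) ^+ 2 by ring.
by rewrite -E2 E1; ring.
Qed.

Let expf_pred (c : F) : c ^+ p = c -> c != 0 -> c ^+ p.-1 = 1.
Proof. by move=> cp c0; apply: (mulfI c0); rewrite -exprS prednK // cp mulr1. Qed.

Let norm_surj_dvd d : ((p ^ d + 1) * p.-1 %| (p ^ n).-1)%N -> norm_surj d.
Proof.
move=> /dvdnP[q Eq] c cp c0.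
have [||mu _ muc] := @finField_exists_root F (p ^ d + 1) c; last by exists mu.
  by rewrite cF Eq mulnC -mulnA dvdn_mulr.
rewrite cF Eq mulnCA mulKn ?addn1 // exprM.
by rewrite exprAC expf_pred ?expr1n.
Qed.

(** Nonzero solutions satisfy z^D = -1. They exist exactly when (p^n - 1) / D is even, and that
    quotient is a sum of n / (2d) odd powers of p. *)
Let card_opp_root d : (d + d %| n)%N -> (0 < d)%N ->
  #|[set z : F | z ^+ (p ^ (d + d)) == - z]| =
  if odd (n %/ (d + d)) then 1%N else (p ^ (d + d))%N.
Proof.
move=> dn d0; set D := (p ^ (d + d)).-1.
have D0 : (0 < D)%N by rewrite /D -subn1 subn_gt0 -{1}(expn0 p) ltn_exp2l // addn_gt0 d0.
have pD : (p ^ (d + d) = D.+1)%N by rewrite /D prednK // expn_gt0 p_gt0.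
have DN : (D %| #|F|.-1)%N by apply: dvdn_pred_card dn.
rewrite (cardsD1 0) inE expr0n gtn_eqF ?expn_gt0 ?p_gt0 // oppr0 eqxx /=.
have -> : [set z : F | z ^+ (p ^ (d + d)) == - z] :\ 0 = [set z : F | z ^+ D == -1].
  apply/setP=> z; rewrite !inE; have [->|z0] /= := eqVneq z 0.
    by rewrite expr0n gtn_eqF // eq_sym oppr_eq0 oner_eq0.
  by rewrite pD exprS -[X in _ == - X]mulr1 -mulrN (inj_eq (mulfI z0)).
rewrite finField_card_root ?oppr_eq0 ?oner_eq0 // -signr_odd.
have -> : odd (#|F|.-1 %/ D) = odd (n %/ (d + d)).
  rewrite cF -{1}(divnK dn) mulnC expnM predn_exp -/D mulKn //.
  elim: (n %/ (d + d))%N => [|m IH]; first by rewrite big_ord0.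
  by rewrite big_ord_recr /= oddD IH !oddX odd_p !orbT addbT.
case: (odd _); last by rewrite expr0 eqxx pD.
by rewrite expr1 (negbTE N1_neq1).
Qed.

(* The group of (p ^ d + 1)-th roots of unity acts freely on the nonzero
   solutions of tr (x ^ (p ^ d + 1)) = t. *)
Let form_mod d (h := fun x : F => x ^+ (p ^ d + 1)) :
  ((p ^ d + 1) %| (p ^ n).-1)%N ->
  exists q : int, (M h 0)%:Z - (M h 1)%:Z = 1 + q * (p ^ d + 1)%:Z.
Proof.
move=> dN; have dvd (P : pred F) :
    (p ^ d + 1 %| \sum_(v | P v && (v != 0%R)) #|[set x : F | x ^+ (p ^ d + 1) == v]|)%N.
  by apply: dvdn_sum => v /andP[_ v0]; apply: dvdn_finField_card_root; rewrite ?cF.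
have [b Mb] : exists b, M h 1%R = (b * (p ^ d + 1))%N.
  apply/dvdnP; rewrite (card_sum_fiber h (fun v => tr v == 1)).
  rewrite (eq_bigl (fun v => (tr v == 1) && (v != 0))) ?(dvd (fun v => tr v == 1)) // => v.
  by have [->|] := eqVneq v 0; rewrite ?andbT // (trp0 n pF) eq_sym oner_eq0.
have [a Ma] : exists a, M h 0%R = (1 + a * (p ^ d + 1))%N.
  rewrite (card_sum_fiber h (fun v => tr v == 0)) (bigD1 0) ?(trp0 n pF) //=.
  have /dvdnP[a ->] := dvd (fun v => tr v == 0); exists a; congr (_ + _)%N.
  rewrite -(cards1 (0 : F)); apply: eq_card => x; rewrite !inE /h expf_eq0 addn1 //.
by exists (a%:Z - b%:Z); rewrite Ma Mb !(PoszD, PoszM); ring.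
Qed.

(** [form_square] gives S = R or S = -R. Modulo p^d + 1, S is 1 by [form_mod] and R is -1, which
    selects S = -R. *)
Lemma hermitian_dist d e : (0 < d)%N -> n = (2 * d * e)%N ->
  trp_dist (fun x => x ^+ (p ^ d + 1)) (- (p ^ (d * (e + ~~ odd e)))%:Z).
Proof.
move=> d0 nE; pose h (x : F) := x ^+ (p ^ d + 1).
have e0 : (0 < e)%N by move: n_gt0; rewrite nE muln_gt0 => /andP[].
have dn : (d + d %| n)%N by rewrite nE addnn -mul2n dvdn_mulr.
have ne : (n %/ (d + d) = e)%N by rewrite nE addnn -mul2n mulKn ?muln_gt0 ?d0.
have r3 : (3 <= p ^ d)%N by apply: leq_trans p_gt2 _; rewrite -{1}[p]expn1 leq_exp2l.
have rrN : ((p ^ d + 1) * (p ^ d).-1 %| (p ^ n).-1)%N.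
  have := dvdn_pred_card cF dn; rewrite cF; congr (_ %| _)%N.
  by rewrite expnD -[(p ^ d)%N]prednK ?(leq_trans _ r3) //=; clear; nia.
have ns : norm_surj d.
  by apply: norm_surj_dvd; apply: dvdn_trans rrN; rewrite dvdn_mul // dvdn_pred_predX.
have [q Sq] := form_mod (dvdn_trans (dvdn_mulr _ (dvdnn _)) rrN).
have := form_square ns; rewrite card_opp_root // ne -/h.
have := trp_dist_scale (scale_form ns); rewrite -/h.
move: Sq; rewrite -/h; set S := _ - _ => Sq distS S2.
suff -> : - (p ^ (d * (e + ~~ odd e)))%:Z = S by [].
set R := (p ^ (d * (e + ~~ odd e)))%N.
have R0 : (0 < R)%N by rewrite expn_gt0 p_gt0.
have WR : ((if odd e then 1 else p ^ (d + d)) * p ^ n = R * R)%N.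
  by rewrite /R -expnD nE; case: (odd e) => /=; rewrite ?mul1n -?expnD; congr (_ ^ _)%N; clear; lia.
have {S2} : (S - R%:Z) * (S + R%:Z) = 0.
  by rewrite -subr_sqr S2 WR PoszM expr2 subrr.
(* R is an odd power of p^d, hence -1 modulo p^d + 1; the witness [b] is built in steps of
   (p^d)^2. *)
have [b Rb] : exists b : int, R%:Z + 1 = b * (p ^ d + 1)%:Z.
  have [f fE] : exists f, (e + ~~ odd e = f.*2.+1)%N.
    exists (e./2)%N; rewrite -{1}[e]odd_double_half; case: (odd e) => /=; clear; lia.
  rewrite /R fE expnM; elim: f {fE} => [|f [b IH]]; first by exists 1; rewrite expn1 mul1r PoszD.
  exists ((p ^ d)%:Z ^+ 2 * b - (p ^ d)%:Z + 1).
  rewrite doubleS 2!expnS; move: IH; move: ((p ^ d) ^ _)%N => X IH.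
  have XE : X%:Z = b * (p ^ d + 1)%:Z - 1 by rewrite -IH addrK.
  by rewrite !PoszM XE PoszD; ring.
move/eqP; rewrite mulf_eq0 => /orP[|/eqP SR]; last by rewrite -[S](addrK R%:Z) SR sub0r.
(* S = R would give r + 1 | (R + 1) - (R - 1) = 2. *)
rewrite subr_eq0 => /eqP SR; exfalso.
have : (b - q) * (p ^ d + 1)%:Z = 2 by rewrite mulrBl -Rb -SR Sq; ring.
move: (b - q) (p ^ d)%N r3 => c r r3; clear -r3 => cr.
by have [c0|c1] : c <= 0 \/ 1 <= c; [lia | nia | nia].
Qed.

Let expN_quarter : (4 %| (p ^ n).-1)%N -> exists i : F, i ^+ 2 = -1.
Proof.
move=> N4; have [||y _ y2] := @finField_exists_root F 2 (-1); last by exists y.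
  by rewrite cF (dvdn_trans _ N4).
rewrite cF; case/dvdnP: N4 => q ->; rewrite (_ : (q * 4 = q * 2 * 2)%N) ?mulnK //.
  by rewrite mulnC exprM expr2 mulrNN mulr1 expr1n.
by rewrite -mulnA.
Qed.

(** For P = p^h congruent to 1 modulo 4, a linear substitution turns x^2 into the Hermitian form
    x^(P+1) up to trace 0. For P congruent to 3, [form_square] leaves only the sign open, and two
    complementary isotropic subspaces fix it. *)
Lemma quadratic_dist h : n = h.*2 ->
  trp_dist (fun x => x ^+ 2) (- (-1) ^+ (odd h && (p %% 4 == 3)%N) * (p ^ h)%:Z).
Proof.
move=> nE; set P := (p ^ h)%N; pose sq (x : F) := x ^+ 2.
have h0 : (0 < h)%N by move: n_gt0; rewrite nE double_gt0.
have PP : (p ^ n = P * P)%N by rewrite nE -addnn expnD.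
have oP : odd P by rewrite oddX odd_p orbT.
have P4 : (P %% 4 == 3)%N = odd h && (p %% 4 == 3)%N. by apply: odd_pow_mod4.
rewrite -P4.
have N4 : (4 %| (p ^ n).-1)%N.
  by rewrite PP -[P]odd_double_half oP; apply/dvdnP; exists (P./2 * P./2.+1)%N; clear; nia.
have PPN : ((p ^ n).-1 = P.-1 * P.+1)%N.
  by rewrite PP -[P]prednK ?odd_gt0 //=; clear; nia.
have [i i2] := expN_quarter N4.
have i_neq0 : i != 0 by apply/eqP=> i0; move/eqP: i2; rewrite i0 expr0n eq_sym oppr_eq0 oner_eq0.
have iP : i ^+ P = if (P %% 4 == 3)%N then - i else i.
  rewrite -[P in LHS]odd_double_half oP exprD expr1 -mul2n exprM i2 -signr_odd.
  have -> : odd P./2 = (P %% 4 == 3)%N by move: oP; clear; lia.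
  by case: ifP => _; rewrite ?expr1 ?mulrN1 ?expr0 ?mulr1.
have twoP : 2%:R ^+ P = 2%:R :> F by rewrite -[2%:R]/(1 + 1) frobD // expr1n.
case: ifP iP => P3 iP; last first.
  rewrite expr0 mulN1r.
  have PN : (P.+1 %| (p ^ n).-1)%N.
    by rewrite PPN dvdn_mull.
  (* Here i is fixed by the power map P, so -i / 2 lies in the subfield with P elements and is a
     norm. *)
  have [mu mu0 muE] : exists2 mu : F, mu != 0 & mu ^+ P.+1 = - i / 2%:R.
    apply: finField_exists_root; first by rewrite cF.
    have -> : (#|F|.-1 %/ P.+1 = P.-1)%N.
      by rewrite cF PPN mulnK.
    have nz : - i / 2%:R != 0 by rewrite mulf_neq0 ?oppr_eq0 ?invr_eq0.
    apply: (mulfI nz); rewrite -exprS prednK ?odd_gt0 // mulr1 expr_div_n frobN // -/P iP.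
    by rewrite twoP.
  have herm : trp_dist (fun x => x ^+ (p ^ h + 1)) (- P%:Z).
    by have := @hermitian_dist h 1 h0; rewrite muln1 nE mul2n addn0 muln1 => /(_ erefl).
  move=> t tp; rewrite -(herm t tp); congr (_ * Posz _).
  (* The square of [psi u] is -(i/2) u^(P+1) plus a term y - y^P of trace 0. *)
  pose psi (u : F) := (u - i * u ^+ P) / 2%:R.
  have psi_inj : injective psi.
    move=> u v; rewrite /psi => /(mulIf (invr_neq0 two_neq0)) uv.
    have {uv} w : (u - v) = i * (u - v) ^+ P.
      rewrite frobB // mulrBr -/P; apply/eqP; rewrite -subr_eq0; apply/eqP.
      rewrite -[RHS](subrr (u - i * u ^+ P)) {2}uv; ring.
    apply/eqP; rewrite -subr_eq0; apply/eqP/self_opp0.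
    rewrite {1}w {1}w exprMn iP -exprM -PP -cF expf_card mulrA -expr2 i2 mulN1r //.
  rewrite -(card_preimset _ psi_inj) -[RHS](card_preimset _ (mulfI mu0)).
  apply: eq_card => u; rewrite !inE; congr (_ == _).
  rewrite addn1 [in RHS]exprMn muE /psi expr_div_n sqrrB.
  have -> : (u ^+ 2 - u * (i * u ^+ P) *+ 2 + (i * u ^+ P) ^+ 2) / 2%:R ^+ 2 =
     - i / 2%:R * u ^+ P.+1 + ((u / 2%:R) ^+ 2 - ((u / 2%:R) ^+ 2) ^+ P).
    have -> : ((u / 2%:R) ^+ 2) ^+ P = (u ^+ P / 2%:R) ^+ 2 by rewrite exprAC expr_div_n twoP.
    rewrite [(i * _) ^+ 2]exprMn i2 (exprS u P); field.
    by rewrite two_neq0 (natrM F 2 2) mulf_neq0.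
  by rewrite (trpD n pF) (trpB n pF) (trp_frob cF) subrr addr0.
rewrite expr1 opprK mul1r.
have ns : norm_surj 0.
  apply: norm_surj_dvd; rewrite expn0.
  rewrite PPN mulnC dvdn_mul ?dvdn_pred_predX //.
  by rewrite -[P]odd_double_half oP; apply/dvdnP; exists (P./2.+1); clear; lia.
have card_line c : c ^+ P.+1 = 1 -> #|[set u : F | u ^+ P == c * u]| = P.
  move=> cP; have P1 : (0 < P.-1)%N.
    by rewrite -subn1 subn_gt0 -{1}(expn0 p) ltn_exp2l.
  have c0 : c != 0 by apply/eqP=> c0; move/eqP: cP; rewrite c0 expr0n eq_sym oner_eq0.
  rewrite (cardsD1 0) inE expr0n gtn_eqF ?odd_gt0 // mulr0 eqxx /=.
  have -> : [set u : F | u ^+ P == c * u] :\ 0 = [set u : F | u ^+ P.-1 == c].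
    apply/setP=> u; rewrite !inE; have [->|u0] /= := eqVneq u 0.
      by rewrite expr0n gtn_eqF // eq_sym (negbTE c0).
    by rewrite -[in LHS](prednK (odd_gt0 oP)) exprSr (inj_eq (mulIf u0)).
  rewrite finField_card_root ?cF ?PPN ?dvdn_mulr // mulKn // cP eqxx add1n.
  exact: prednK (odd_gt0 oP).
(* On these eigenspaces of the power map P, squares are sent to their negatives and so have trace
   0. *)
pose U := [set u : F | u ^+ P == - i * u]; pose V := [set v : F | v ^+ P == i * v].
have iP1 : i ^+ P.+1 = 1 by rewrite exprS iP mulrN -expr2 i2 opprK.
have cU : #|U| = P by apply: card_line; rewrite exprNn iP1 -signr_odd /= oP expr0 mul1r.
have cV : #|V| = P by apply: card_line.
have iso (x : F) : (x ^+ 2) ^+ P = - x ^+ 2 -> tr (x ^+ 2) = 0.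
  by move=> xP; apply: self_opp0; rewrite -(trpN n pF) -xP (trp_frob cF).
have isoU u : u \in U -> tr (u ^+ 2) = 0.
  by rewrite inE => /eqP uP; apply: iso; rewrite exprAC uP exprMn sqrrN i2 mulN1r.
have isoV v : v \in V -> tr (v ^+ 2) = 0.
  by rewrite inE => /eqP vP; apply: iso; rewrite exprAC vP exprMn i2 mulN1r.
(* On a sum u + v the form is twice the trace of uv, so [A] injects into the zeros; each u admits at
   least P / p values of v. *)
pose A := [set z : F * F | (z.1 \in U) && (z.2 \in V) && (tr (z.1 * z.2) == 0)].
have A_le : (#|A| <= M sq 0%R)%N.
  have inj : {in A &, injective (fun z : F * F => z.1 + z.2)}.
    move=> [u v] [u' v']; rewrite !inE /= => /andP[/andP[/eqP uU /eqP vV] _].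
    move=> /andP[/andP[/eqP u'U /eqP v'V] _] E.
    have w : u - u' = v' - v by rewrite -(addrK v u) E; ring.
    have wU : (u - u') ^+ P = - i * (u - u') by rewrite frobB // -/P uU u'U mulrBr.
    have wV : (u - u') ^+ P = i * (u - u') by rewrite w frobB // -/P vV v'V mulrBr.
    have : i * (u - u') = 0 by apply: self_opp0; rewrite -mulNr -wU.
    move/eqP; rewrite mulf_eq0 (negbTE i_neq0) /= => u0.
    by move: w; rewrite (eqP u0) => /esym/eqP; rewrite !subr_eq0 in u0 *; rewrite (eqP u0) => /eqP ->.
  rewrite -(card_in_imset inj); apply: subset_leq_card; apply/subsetP=> _ /imsetP[[u v] + ->].
  rewrite !inE /= => /andP[/andP[uU vV] /eqP uv].
  rewrite /sq sqrrD !(trpD n pF) isoU ?inE // isoV ?inE // uv.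
  by rewrite !addr0.
have A_ge : (P * P <= p * #|A|)%N.
  have -> : #|A| = (\sum_(u in U) #|[set v in V | tr (u * v)%R == 0%R]|)%N.
    rewrite (card_set_pair (fun u v => (u \in U) && (v \in V) && (tr (u * v) == 0))).
    rewrite [RHS]big_mkcond; apply: eq_bigr => u _; case: (u \in U) => //=.
    by rewrite -(cards0 F); apply: eq_card => v; rewrite !inE.
  rewrite -{1}cU big_distrr /= -sum_nat_const; apply: leq_sum => u _.
  have := @card_le_ker F V [set t : F | t ^+ p == t] (fun v => tr (u * v)).
  rewrite cV (card_prime_subfield pF cF); apply=> [v v'|v v'|v _].
  - by rewrite !inE => /eqP vV /eqP v'V; rewrite frobB // -/P vV v'V mulrBr.
  - by rewrite mulrBr (trpB n pF).
  - by rewrite inE (trp_expp pF cF).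
have := form_square ns; rewrite addn0 expn0.
have -> : [set z : F | z ^+ 1 == - z] = [set 0].
  apply/setP=> z; rewrite !inE expr1; apply/eqP/eqP => [/self_opp0 //|->].
  by rewrite oppr0.
rewrite cards1 mul1n PP PoszM -expr2 => /eqP.
have := trp_dist_scale (scale_form ns); rewrite expn0 -/sq.
have M0 := trp_dist_scale (scale_form ns) exp0p; rewrite expn0 -/sq in M0.
rewrite eqf_sqr => distS /orP[/eqP S1|/eqP S1]; first by rewrite -S1.
(* S = -P would give p M(0) = P^2 - (p - 1) P, below the bound P^2 obtained from [A]. *)
exfalso; move: M0; rewrite S1 eqxx muln1 PP.
have := leq_trans A_ge (leq_mul (leqnn p) A_le).
have : (0 < P)%N by apply: odd_gt0.
by move: (M sq 0%R) (P) p_gt1 => a Q p1; clear -p1; nia.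
Qed.


End Forms.

(** * The gcd of p^k + 1 and p^n - 1 *)

Section GcdExp.
Local Open Scope nat_scope.
Variables (p k n : nat).
Hypotheses (odd_p : odd p) (k_gt0 : 0 < k) (n_gt0 : 0 < n).

Let d := gcdn k n.
Let d_gt0 : 0 < d. Proof. by rewrite gcdn_gt0 k_gt0. Qed.
Let p_gt0 : 0 < p. Proof. exact: odd_gt0. Qed.

Let exp_mod1 g a b : p ^ a = 1 %[mod g] -> a %| b -> p ^ b = 1 %[mod g].
Proof. by move=> pa /dvdnP[q ->]; rewrite mulnC expnM -modnXm pa modnXm exp1n. Qed.

Let exp_mod1_gcd g a b : 0 < a ->
  p ^ a = 1 %[mod g] -> p ^ b = 1 %[mod g] -> p ^ gcdn a b = 1 %[mod g].
Proof.
move=> a0 pa pb; have [s t E _] := egcdnP b a0.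
have := exp_mod1 pa (dvdn_mull s (dvdnn a)); rewrite E expnD -modnMml.
by rewrite (exp_mod1 pb (dvdn_mull t (dvdnn b))) modnMml mul1n.
Qed.

Let mod_dvd g a : g %| (p ^ a).-1 -> p ^ a = 1 %[mod g].
Proof.
move=> ga; apply/eqP; rewrite eqn_mod_dvd ?expn_gt0 ?p_gt0 //.
by rewrite subn1.
Qed.

Let dvd_double g a : g %| p ^ a + 1 -> p ^ (a * 2) = 1 %[mod g].
Proof.
move=> ga; apply: mod_dvd; apply: dvdn_trans ga _; apply/dvdnP; exists (p ^ a).-1.
rewrite expnM -(@prednK (p ^ a)) ?expn_gt0 ?p_gt0 //=.
by move: (p ^ a).-1 => x; clear; nia.
Qed.

Let g := gcdn (p ^ k + 1) (p ^ n).-1.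

Let g_exp : p ^ gcdn (k * 2) n = 1 %[mod g].
Proof.
apply: exp_mod1_gcd; first by rewrite muln_gt0 k_gt0.
  by apply: dvd_double; apply: dvdn_gcdl.
by apply: mod_dvd; apply: dvdn_gcdr.
Qed.

Let gcd_double : gcdn (k * 2) n = d * gcdn 2 (n %/ d).
Proof.
have kE : k = d * (k %/ d) by rewrite mulnC divnK ?dvdn_gcdl.
have nE : n = d * (n %/ d) by rewrite mulnC divnK ?dvdn_gcdr.
have cop : coprime (n %/ d) (k %/ d).
  by rewrite coprime_sym /coprime -(eqn_pmul2l d_gt0) muln_gcdr -kE -nE muln1.
rewrite [in LHS]nE {1}kE -mulnA -muln_gcdr; congr (_ * _).
by rewrite gcdnC Gauss_gcdr // gcdnC.
Qed.

(** Here gcd(2k, n) = d divides k, so p^k is 1 modulo the gcd g, which therefore divides 2; both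
    numbers are even. *)
Lemma gcd_exp_odd : odd (n %/ d) -> gcdn (p ^ k + 1) (p ^ n).-1 = 2.
Proof.
move=> odd_nd; have g2 : gcdn 2 (n %/ d) = 1.
  by apply/eqP; rewrite -/(coprime 2 _) coprime2n.
have := g_exp; rewrite gcd_double g2 muln1 => /exp_mod1/(_ (dvdn_gcdl k n)) pk.
apply/eqP; rewrite eqn_dvd -/g; apply/andP; split.
  have : g %| p ^ k + 1 by apply: dvdn_gcdl.
  by rewrite /dvdn -modnDml pk modnDml.
have oX m : odd (p ^ m) by rewrite oddX odd_p orbT.
by rewrite dvdn_gcd !dvdn2 oddD oX -subn1 oddB ?expn_gt0 ?p_gt0 // oX.
Qed.

(** Since k / d is odd, p^k agrees with p^d modulo any number for which p^(2d) is 1. This applies to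
    the gcd, as gcd(2k, n) = 2d, and to p^d + 1. *)
Lemma gcd_exp_even : ~~ odd (n %/ d) -> gcdn (p ^ k + 1) (p ^ n).-1 = p ^ d + 1.
Proof.
move=> even_nd; have g2 : gcdn 2 (n %/ d) = 2 by rewrite -gcdn_modr modn2 (negbTE even_nd).
have kE : k = d * (k %/ d) by rewrite mulnC divnK ?dvdn_gcdl.
have nE : n = d * (n %/ d) by rewrite mulnC divnK ?dvdn_gcdr.
have odd_kd : odd (k %/ d).
  rewrite -[odd _]negbK -dvdn2; apply/negP=> k2.
  have : 2 %| gcdn (k %/ d) (n %/ d) by rewrite dvdn_gcd k2 dvdn2.
  have -> : gcdn (k %/ d) (n %/ d) = 1; last by [].
  by apply/eqP; rewrite -(eqn_pmul2l d_gt0) muln_gcdr -kE -nE muln1.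
have pk m : p ^ (d * 2) = 1 %[mod m] -> p ^ k + 1 = p ^ d + 1 %[mod m].
  move=> pd; rewrite -modnDml kE -[k %/ d]odd_double_half odd_kd mulnDr muln1 -mul2n mulnA.
  by rewrite expnD -modnMmr (exp_mod1 pd (dvdn_mulr _ (dvdnn _))) modnMmr muln1 modnDml.
apply/eqP; rewrite eqn_dvd -/g; apply/andP; split.
  have := g_exp; rewrite gcd_double g2 => /pk E.
  by rewrite /dvdn -E; apply: dvdn_gcdl.
have pd := dvd_double (dvdnn (p ^ d + 1)); rewrite dvdn_gcd; apply/andP; split.
  by rewrite /dvdn (pk _ pd) modnn.
have : p ^ n = 1 %[mod p ^ d + 1].
  by apply: exp_mod1 pd _; rewrite [X in _ %| X]nE dvdn_pmul2l // dvdn2.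
by move/eqP; rewrite eqn_mod_dvd ?expn_gt0 ?p_gt0 // subn1.
Qed.

End GcdExp.

(** * Character sums and point counts for all exponents k *)

Section FormSum.
Variables (F : finFieldType) (p n : nat).
Hypotheses (pF : p \in [pchar F]) (cF : #|F| = (p ^ n)%N) (odd_p : odd p).

Let n_gt0 : (0 < n)%N.
Proof. by have := finNzRing_gt1 F; rewrite cF; case: n. Qed.

Local Notation tr := (@trp F p n).

Lemma card_form_odd k (t : F) : (0 < k)%N -> odd (n %/ gcdn k n) ->
  #|[set x : F | tr (x ^+ (p ^ k + 1)) == t]| = #|[set x : F | tr (x ^+ 2) == t]|.
Proof.
move=> k0 odd_nd; have := finField_card_pow_gcd (fun v : F => tr v == t) (ltn_addl (p ^ k) (ltn0Sn 0)).
by rewrite cF gcd_exp_odd.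
Qed.

Lemma card_form_even k (t : F) : (0 < k)%N -> ~~ odd (n %/ gcdn k n) ->
  #|[set x : F | tr (x ^+ (p ^ k + 1)) == t]| = #|[set x : F | tr (x ^+ (p ^ gcdn k n + 1)) == t]|.
Proof.
move=> k0 even_nd; have := finField_card_pow_gcd (fun v : F => tr v == t) (ltn_addl (p ^ k) (ltn0Sn 0)).
by rewrite cF gcd_exp_even.
Qed.

Theorem form_dist k : (0 < k)%N -> ~~ odd n ->
  trp_dist p n (fun x : F => x ^+ (p ^ k + 1)) (- (p ^ n./2)%:Z * sum_factor p k n).
Proof.
move=> k0 even_n t tp /=; rewrite /sum_factor; set d := gcdn k n; set e := (n %/ d)%N.
have d0 : (0 < d)%N by rewrite gcdn_gt0 k0.
have nE : (n = d * e)%N by rewrite mulnC divnK ?dvdn_gcdr.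
case: ifP => [odd_e|/negbT even_e].
  rewrite card_form_odd //.
  have /= -> := quadratic_dist pF cF odd_p (h := n./2) _ tp; first by ring.
  by rewrite -[LHS]odd_double_half (negbTE even_n).
have eE : e = e./2.*2 by rewrite -[LHS]odd_double_half (negbTE even_e).
have nE2 : n = (2 * d * e./2)%N by rewrite [LHS]nE [in LHS]eE -mul2n; clear; lia.
rewrite card_form_even // -/d; have /= -> := hermitian_dist pF cF odd_p d0 nE2 tp.
(* The case 4 | e of [sum_factor] is the extra factor p^d in [hermitian_dist]. *)
have -> : (4 %| e)%N = ~~ odd e./2 by move: (eE); clear; lia.
have -> : n./2 = (d * e./2)%N by rewrite [X in X./2]nE {1}eE -doubleMr doubleK.
rewrite mulnDr expnD PoszM; case: (odd _) => /=; rewrite ?muln0 ?muln1 ?expn0; ring.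
Qed.

Lemma card_affine_points k (a : 'F_p) :
  #|affine_points k a F| =
  (p * #|[set x : F | tr (x ^+ (p ^ k + 1)) == (n%:R * ((a : nat)%:R ^+ 2 / 4%:R))%R]|)%N.
Proof.
set b : F := (a : nat)%:R.
have natp m : m%:R ^+ p = m%:R :> F by rewrite -(pFrobenius_autE pF) pFrobenius_aut_nat.
have bp : b ^+ p = b by apply: natp.
have p2 : ~~ (p %| 2)%N by apply/negP=> /(dvdn_leq (isT : 0 < 2)%N); have := prime_gt1 (pcharf_prime pF); lia.
have two0 : 2%:R != 0 :> F by rewrite -(dvdn_pcharf pF).
have four0 : 4%:R != 0 :> F by rewrite (natrM F 2 2) mulf_neq0.
rewrite /affine_points (card_artin_schreier_curve pF cF (fun x => x ^+ (p ^ k + 1) + b * x)).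
congr (_ * _)%N; rewrite -(card_preimset _ (addIr (- (b / 2%:R)))).
have cp m (c : F) : c ^+ p = c -> (c / m%:R) ^+ p = c / m%:R by move=> cc; rewrite expr_div_n cc natp.
have b4 : (b ^+ 2 / 4%:R) ^+ p = b ^+ 2 / 4%:R by apply: cp; rewrite exprAC bp.
apply: eq_card => x; rewrite !inE -(trp_const n b4) -[RHS]subr_eq0 -(trpB n pF).
congr (_ == _); set c := b / 2%:R.
have cp2 : c ^+ p = c by apply: cp.
(* As c = b / 2 lies in the prime field, the last bracket is a Frobenius difference and has trace
   0. *)
have -> : (x - c) ^+ (p ^ k + 1) + b * (x - c) =
    (x ^+ (p ^ k + 1) - b ^+ 2 / 4%:R) - (c * x ^+ (p ^ k) - c * x).
  rewrite addn1 !exprSr (frobB pF) (fixed_frob k cp2) /c; field.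
  by rewrite two0 four0.
rewrite (trpB n pF _ (c * _ - _)) (trpB n pF (c * _)) !(trpZ _ _ cp2) (trp_frob cF) subrr.
by rewrite subr0.
Qed.

End FormSum.

(** * Comparison of the point counts of the two curves *)

Theorem mainTheorem1 (p : nat) (pr_p : prime p) (odd_p : odd p) (a : 'F_p)
    (k m : nat) (k_gt0 : (0 < k)%N) (m_gt0 : (0 < m)%N)
    (Lk Lkm : {poly int})
    (Lk_def : is_curve_Lpolynomial pr_p k a Lk)
    (Lkm_def : is_curve_Lpolynomial pr_p (k * m)%N a Lkm) :
  dvd_polyZ Lk Lkm.
Proof.
apply: (dvd_Lpolynomial Lk_def Lkm_def).
have km_gt0 : (0 < k * m)%N by rewrite muln_gt0 k_gt0.
have p_gt2 : (2 < p)%N by have := prime_gt1 pr_p; move: odd_p; clear; lia.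
(* This factor is p [t = 0] - 1 for the target trace t = n a^2 / 4, which vanishes when a = 0 or p
   divides n. *)
have E1 : effective (fun n => if a == 0 then p%:R - 1 else (p * (p %| n)%N)%:R - 1).
  case: (a == 0); last exact/effective_dvdn/prime_gt0.
  by apply: effective_nonneg; rewrite subr_ge0 ler1n prime_gt0.
have E23 := effectiveM (effective_half_power p)
  (factor_diff_effective p_gt2 k_gt0 (dvdn_mulr m (dvdnn k)) km_gt0).
apply: effective_ext (effectiveM E1 E23) => n n_gt0 /=.
rewrite /curve_points !natrD opprD addrACA subrr addr0.
have pF := pchar_Fpn pr_p n; have cF := card_Fpn pr_p n_gt0.
rewrite !(card_affine_points pF cF) //; set t := _ * _ : Fpn pr_p n.
have tp : t ^+ p = t.
  have natp i : i%:R ^+ p = i%:R :> Fpn pr_p n by rewrite -(pFrobenius_autE pF) pFrobenius_aut_nat.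
  by rewrite /t exprMn expr_div_n exprAC !natp.
have t0 : (t == 0) = (a == 0) || (p %| n)%N.
  have four : 4%:R != 0 :> Fpn pr_p n.
    rewrite -(dvdn_pcharf pF) (_ : 4 = 2 ^ 2)%N // Euclid_dvdX // andbT.
    by apply/negP=> /(dvdn_leq (isT : 0 < 2)%N); rewrite leqNgt p_gt2.
  rewrite /t !mulf_eq0 invr_eq0 (negbTE four) orbF -!(dvdn_pcharf pF) orbb orbC.
  congr (_ || _); apply/idP/eqP => [pa|->]; last by rewrite dvdn0.
  have := ltn_ord a; rewrite [X in (_ < X)%N](Fp_cast pr_p) => ap.
  apply/val_inj => /=; have [//|a0] := posnP a.
  by have := dvdn_leq a0 pa; rewrite leqNgt ap.
rewrite /factor_diff; have [odd_n|even_n] := boolP (odd n).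
  (* For n odd, both forms have the value distribution of x^2, so the counts agree. *)
  have odd_quot j : odd (n %/ gcdn j n).
    have : odd (n %/ gcdn j n * gcdn j n)%N by rewrite divnK ?dvdn_gcdr.
    by rewrite oddM => /andP[].
  by rewrite !(card_form_odd cF odd_p _ _ (odd_quot _)) // mul0r mulr0 subrr.
have := form_dist pF cF odd_p k_gt0 even_n tp; have := form_dist pF cF odd_p km_gt0 even_n tp.
move=> /= Ekm Ek.
have -> : (if a == 0 then p%:R - 1 else (p * (p %| n)%N)%:R - 1) =
    ((p * (t == 0%R))%N%:Z - 1)%:~R :> algC.
  by rewrite t0 rmorphB /= -pmulrn; case: (a == 0); rewrite ?muln1.
rewrite !pmulrn -!rmorphM -rmorphB; congr (_%:~R).
by rewrite !PoszM Ek Ekm; ring.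
Qed.
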